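(* Let $N\ge1$ and let $\alpha,\beta$ be complex numbers with $\mathrm{Re}(\alpha)>0$ and $\mathrm{Re}(\beta)>0$. Let $$S_N(\alpha,\beta)=\int_{\Omega_N}P(1)^{\alpha-1}\,|P(-1)|^{\beta-1}\,dV.$$ Then $$\begin{aligned} S_{N}(\alpha,\beta) = {}& \prod_{k\ge1,\ 2k \le N}2^{\alpha + \beta + 2k - 2}\, \frac{\Gamma(\alpha +\beta + k-1)\, \Gamma(k)}{\Gamma(\alpha + \beta + 2k - 1)} \prod_{k\ge0,\ 2k+1 \le N} 2^{\alpha + \beta + 2k - 1}\, \frac{\Gamma(\alpha +k)\, \Gamma(\beta + k)}{\Gamma(\alpha + \beta + 2k)}\\ = {}& \prod_{k=1}^{N} \frac{2^{\alpha + \beta + k - 2}}{\Gamma(\alpha + \beta + k - 1)} \prod_{k\ge1,\ 2k \le N} \Gamma(\alpha +\beta + k-1)\, \Gamma(k) \prod_{k\ge1,\ 2k-1 \le N} \Gamma(\alpha +k-1)\, \Gamma(\beta + k-1).\end{aligned}$$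
   Context: Identify a monic real polynomial $P(x)=x^N+a_1x^{N-1}+\cdots+a_N$ with $(a_1,\dots,a_N)\in\mathbf{R}^N$; $\Omega_N\subset\mathbf{R}^N$ is the region of monic real polynomials of degree $N$ all of whose complex roots have absolute value at most $1$, and $dV$ is Lebesgue measure. In the integral $P$ is the polynomial corresponding to the point of integration; note $P(1)\ge0$ on $\Omega_N$. *)

(* Defs.v *)
From HB Require Import structures.
From mathcomp Require Import all_boot all_order all_algebra.
From mathcomp Require Import all_classical all_reals all_analysis.
From mathcomp Require Import complex.

Set Implicit Arguments.
Unset Strict Implicit.
Unset Printing Implicit Defensive.

Import Order.TTheory GRing.Theory Num.Theory.
Import numFieldNormedType.Exports.

Local Open Scope classical_set_scope.
Local Open Scope ring_scope.
Local Open Scope complex_scope.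

(* MathComp-Analysis equips [n.-tuple T] with its product sigma-algebra but has
   no Lebesgue measure there: it is built by induction on the dimension, as the
   image of the product measure on R * R^n under the identification of R * R^n
   with R^n.+1. *)
Section cons_measure.
Context (R : realType) (n : nat).
Local Notation RT := (measurableTypeR R).

Definition cons_pair (p : RT * n.-tuple RT) : n.+1.-tuple RT :=
  [tuple of p.1 :: p.2].

Lemma measurable_cons_pair : measurable_fun setT cons_pair.
Proof. exact: measurable_cons. Qed.

Variable mu : {sigma_finite_measure set (n.-tuple RT) -> \bar R}.

Definition cons_measure : set (n.+1.-tuple RT) -> \bar R :=
  pushforward (lebesgue_measure \x mu)%E cons_pair.

Let cons_measure0 : cons_measure set0 = 0%E.
Proof. by rewrite /cons_measure /pushforward preimage_set0 measure0. Qed.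

Let cons_measure_ge0 A : (0 <= cons_measure A)%E.
Proof. by rewrite /cons_measure /pushforward; exact: measure_ge0. Qed.

Let measurable_preimage A : measurable A -> measurable (cons_pair @^-1` A).
Proof.
by move=> mA; rewrite -[X in measurable X]setTI; exact: measurable_cons_pair.
Qed.

Let cons_measure_sigma_additive : semi_sigma_additive cons_measure.
Proof.
move=> F mF tF mUF; rewrite /cons_measure /pushforward preimage_bigcup.
apply: measure_semi_sigma_additive.
- by move=> k; exact: measurable_preimage.
- apply/trivIsetP => /= i j _ _ ij; rewrite -preimage_setI.
  by move/trivIsetP : tF => /(_ _ _ _ _ ij) ->//; rewrite preimage_set0.
- by rewrite -preimage_bigcup; exact: measurable_preimage.
Qed.

HB.instance Definition _ := isMeasure.Build _ _ _ cons_measure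
  cons_measure0 cons_measure_ge0 cons_measure_sigma_additive.

Let cons_measure_sigma_finite : sigma_finite setT cons_measure.
Proof.
have /sigma_finiteP[F [TF ndF Foo]] := sigma_finiteT (@lebesgue_measure R).
have /sigma_finiteP[G [TG ndG Goo]] := sigma_finiteT mu.
pose uncons (t : n.+1.-tuple RT) : RT * n.-tuple RT :=
  (thead t, [tuple of behead t]).
have unconsK : cancel uncons cons_pair.
  by move=> t; rewrite /cons_pair/=; apply/val_inj; rewrite [in RHS](tuple_eta t).
have cons_pairK : cancel cons_pair uncons.
  by move=> [x t]; rewrite /uncons /cons_pair/=; congr pair; apply/val_inj.
have muncons : measurable_fun setT uncons.
  apply/measurable_fun_pairP; split.
  - exact: (@measurable_tnth _ RT n.+1 ord0).
  - exact: measurable_behead.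
exists (fun k => uncons @^-1` (F k `*` G k)).
  rewrite -preimage_bigcup (_ : \bigcup_k _ = setT) ?preimage_setT//.
  apply/seteqP; split => // -[x t] _.
  have [i _ Fx] : (\bigcup_i F i) x by rewrite -TF.
  have [j _ Gt] : (\bigcup_j G j) t by rewrite -TG.
  exists (maxn i j) => //; split => /=.
  - by move: x Fx; exact/subsetPset/ndF/leq_maxl.
  - by move: t Gt; exact/subsetPset/ndG/leq_maxr.
move=> k; have [mF Fk] := Foo k; have [mG Gk] := Goo k; split.
  by rewrite -[X in measurable X]setTI; apply: muncons => //; exact: measurableX.
rewrite /cons_measure /pushforward -comp_preimage.
rewrite (_ : uncons \o cons_pair = id); last first.
  by apply/funext => p; exact: cons_pairK.
by rewrite preimage_id product_measure1E// lte_mul_pinfty// ge0_fin_numE.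
Qed.

HB.instance Definition _ := Measure_isSigmaFinite.Build _ _ _ cons_measure
  cons_measure_sigma_finite.

End cons_measure.

Fixpoint lebesgue_tuple (R : realType) (n : nat) :
    {sigma_finite_measure set (n.-tuple (measurableTypeR R)) -> \bar R} :=
  match n with
  | 0 => \d_ [tuple]
  | n'.+1 => cons_measure (lebesgue_tuple R n')
  end.

(* This determines the measure: the value on a box is the product of the
   lengths of its sides. *)
Lemma lebesgue_tuple_box (R : realType) (n : nat)
    (A : 'I_n -> set (measurableTypeR R)) :
  (forall i, measurable (A i)) ->
  lebesgue_tuple R n [set t | forall i, A i (tnth t i)] =
  (\prod_(i < n) lebesgue_measure (A i))%E.
Proof.
elim: n A => [|n IHn] A mA.
  rewrite big_ord0 /= diracE (_ : (_ \in _) = true) //.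
  by apply/mem_set => -[].
pose B (i : 'I_n) := A (lift ord0 i).
rewrite big_ord_recl /= -(IHn B); last by move=> i; exact: mA.
rewrite /cons_measure /pushforward.
rewrite -product_measure1E; first last.
- rewrite (_ : [set _ | _] =
    \bigcap_(i in [set: 'I_n]) [set t : n.-tuple _ | B i (tnth t i)]).
    apply: fin_bigcap_measurable => // i _.
    rewrite -[X in measurable X]setTI.
    exact: (@measurable_tnth _ (measurableTypeR R) n i _ _ (mA _)).
  by apply/seteqP; split => [t h i _|t h i]; exact: h.
- exact: mA.
congr (_ _); apply/seteqP; split => -[x t] /=.
  move=> h; split; first exact: (h ord0).
  by move=> i; have := h (lift ord0 i); rewrite tnthS.
move=> [hx ht] i; case: (unliftP ord0 i) => [j ->|->]; last exact: hx.
by rewrite tnthS; exact: ht.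
Qed.

Section complex_valued.
Context (R : realType).

Definition cintegrable d (T : measurableType d)
    (mu : {measure set T -> \bar R}) (D : set T) (f : T -> R[i]) : Prop :=
  mu.-integrable D (fun x => (complex.Re (f x))%:E) /\
  mu.-integrable D (fun x => (complex.Im (f x))%:E).

Definition cintegral d (T : measurableType d)
    (mu : {measure set T -> \bar R}) (D : set T) (f : T -> R[i]) : R[i] :=
  (\int[mu]_(x in D) complex.Re (f x)) +i*
  (\int[mu]_(x in D) complex.Im (f x)).

(* x ^ s = exp (s ln x) for x > 0; what it is at x <= 0 has no bearing on the
   integrals below, where x >= 0 on the domain and x = 0 on a null set. *)
Definition cpow (x : R) (s : R[i]) : R[i] :=
  (x `^ complex.Re s)%:C *
  (cos (complex.Im s * ln x) +i* sin (complex.Im s * ln x)).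

(* Euler's integral, which is the Gamma function for Re z > 0 *)
Definition Gamma (z : R[i]) : R[i] :=
  cintegral (@lebesgue_measure R) `]0, +oo[
    (fun t : R => cpow t (z - 1) * (expR (- t))%:C).

End complex_valued.

Section region.
Context (R : realType) (N : nat).
Implicit Type a : N.-tuple (measurableTypeR R).

(* x^N + a_1 x^(N-1) + ... + a_N, where a_(i+1) is [tnth a i] *)
Definition monic_poly a : {poly R} :=
  'X^N + \sum_(i < N) (tnth a i : R) *: 'X^(N - i.+1).

Definition Omega : set (N.-tuple (measurableTypeR R)) :=
  [set a | forall z : R[i],
    root (map_poly (real_complex R) (monic_poly a)) z -> `|z| <= 1].

Definition S_integrand (alpha beta : R[i]) a : R[i] :=
  cpow (monic_poly a).[1] (alpha - 1) *
  cpow `|(monic_poly a).[-1]| (beta - 1).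

Definition S_integral (alpha beta : R[i]) : R[i] :=
  cintegral (lebesgue_tuple R N) Omega (S_integrand alpha beta).

End region.

Arguments Omega R N : clear implicits.
Arguments S_integrand {R} N alpha beta a.
Arguments S_integral {R} N alpha beta.

(* Main.v *)
Require Import Defs.
From mathcomp Require Import all_boot all_order all_algebra.
From mathcomp Require Import all_classical all_reals all_analysis.
From mathcomp Require Import complex.
From mathcomp Require Import measurable_realfun ring lra zify.

(** For t in ]-1, 1[, the Schur recursion P |-> x P + t P^*, where P^* is P with
    its coefficients reversed, maps the monic polynomials of degree N - 1 with
    roots in the closed unit disc onto those of degree N with constant term t:
    for |x| > 1 and |r| <= 1, the factor x - r of P dominates the factor
    1 - r' x of P^*, r' being the conjugate of r.  On coefficients it is the linear map I + tJ, J being the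
    reversal, so its Jacobian is a product of powers of 1 + t and 1 - t; and
    P(1), P(-1) are multiplied by 1 + t and, up to sign, by 1 + (-1)^N t.
    Hence S_N = K_N S_(N-1), where K_N is a Beta integral over ]-1, 1[.

    The Beta integral is Gamma(a) Gamma(b) / Gamma(a + b) by the change of
    variables (x, y) = (s (1 + t) / 2, s (1 - t) / 2), and Gamma does not vanish
    where Re z > 0: a zero z would give the zeros z / 2^n, because
    Gamma(z / 2)^2 is a multiple of Gamma(z); then the integrals of
    t^(z / 2^n - 1) (e^(-t) - e^(-2t)) would all be zero, although they converge
    to the integral of the positive function (e^(-t) - e^(-2t)) / t. *)

Set Implicit Arguments.
Unset Strict Implicit.
Unset Printing Implicit Defensive.

Import Order.TTheory GRing.Theory Num.Theory.
Import numFieldNormedType.Exports.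
Local Open Scope classical_set_scope.
Local Open Scope ring_scope.

(** * Linear changes of variables and product integrals *)

(** Every change of variables is reduced to affine substitutions in one variable, combined by
    Tonelli. The reversal J exchanges the first coordinate with the last, so I + tJ splits into 2 by
    2 blocks with rows (1, t) and (t, 1), plus a middle entry 1 + t in odd length; a block is undone
    by a translation of one variable followed by an affine substitution in the other. These formulas
    are proved for nonnegative functions, where no integrability has to be known beforehand, and are
    carried over to complex integrands afterwards, with integrability as a conclusion. Complex
    powers are multiplicative only at positive arguments. The recursion for S_N therefore runs on
    the part of the region where P(1) > 0 and P(-1) is nonzero; what is left out is null, by the
    same recursion. The parity of N enters through the factor 1 + (-1)^N t of P(-1), which joins the
    powers of 1 + t for even N and those of 1 - t for odd N. This is why the products of the theorem
    run over even and odd degrees separately. Gamma must have no zero because the Beta integral is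
    expressed as a quotient. *)

Section affine.
Context (R : realType).
Local Notation mu := (@lebesgue_measure R).
Local Open Scope ereal_scope.

Lemma measurable_itvRT (i : interval R) : measurable ([set` i] : set (measurableTypeR R)).
Proof. exact: measurable_itv. Qed.

Lemma measurable_affine (c d : R) :
  measurable_fun setT (fun x : measurableTypeR R => (c * x + d)%R : measurableTypeR R).
Proof. by apply: measurable_funD => //; exact: measurable_funM. Qed.

(** The measure c times the image of [mu] under x |-> c x + d gives ]a, b] the mass c (b - a) / c
    when a < b. It thus agrees with [mu] on half-open intervals, which determines Lebesgue
    measure. *)
Lemma ge0_integral_affine (c d : R) (f : measurableTypeR R -> \bar R) :
    (0 < c)%R -> measurable_fun setT f -> (forall x, 0 <= f x) ->
  \int[mu]_x f x = \int[mu]_x (c%:E * f (c * x + d)%R).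
Proof.
move=> c0 mf f0; pose g (x : measurableTypeR R) : measurableTypeR R := (c * x + d)%R.
have mg : measurable_fun setT g by exact: measurable_affine.
pose k : {nonneg R} := NngNum (ltW c0).
pose pmu : {measure set (measurableTypeR R) -> \bar R} :=
  measure_function_pushforward__canonical__measure_function_Measure mu mg.
have munique A : measurable A -> mu A = mscale k pmu A.
  apply: lebesgue_measure_unique => _ [[a b]] _ <-.
  rewrite [RHS](_ : _ = c%:E * mu (g @^-1` `]a, b]%classic))//.
  rewrite (_ : g @^-1` _ = `]((a - d) / c)%R, ((b - d) / c)%R]%classic); last first.
    apply/seteqP; split => x /=; rewrite /g !in_itv/= ltr_pdivrMr// ler_pdivlMr//;
    by rewrite ltrBlDr lerBrDr mulrC.
  rewrite !lebesgue_measure_itv/= !lte_fin ltr_pM2r ?invr_gt0// ltrD2r.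
  case: ifPn => _; last by rewrite mule0.
  by rewrite -!EFinB -EFinM; congr _%:E; field; rewrite gt_eqF.
have mfg : measurable_fun setT (f \o g) by exact: (measurableT_comp mf mg).
rewrite ge0_integralZl// ?lee_fin ?ltW//.
transitivity (\int[mscale k pmu]_x f x).
  by apply: eq_measure_integral => A mA _; exact: munique.
rewrite ge0_integral_mscale//; congr (_ * _).
by rewrite (ge0_integral_pushforward mg)//.
Qed.

End affine.

Section tensor.
Context d1 d2 (T1 : measurableType d1) (T2 : measurableType d2) (R : realType).
Variables (m1 : {sigma_finite_measure set T1 -> \bar R})
          (m2 : {sigma_finite_measure set T2 -> \bar R}).
Local Open Scope ereal_scope.

Lemma ge0_integral_tensor (h : T1 -> \bar R) (k : T2 -> \bar R) :
    measurable_fun setT h -> measurable_fun setT k ->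
    (forall x, 0 <= h x) -> (forall y, 0 <= k y) ->
  \int[m1 \x m2]_p (h p.1 * k p.2) = \int[m1]_x h x * \int[m2]_y k y.
Proof.
move=> mh mk h0 k0.
have mhk : measurable_fun setT (fun p : T1 * T2 => h p.1 * k p.2).
  by apply: emeasurable_funM; exact: measurableT_comp.
rewrite fubini_tonelli1//; last by move=> p; exact: mule_ge0.
rewrite /fubini_F /=; under eq_integral do rewrite ge0_integralZl//.
by rewrite ge0_integralZr// integral_ge0.
Qed.

Lemma integrable_tensor (h : T1 -> R) (k : T2 -> R) :
    m1.-integrable setT (EFin \o h) -> m2.-integrable setT (EFin \o k) ->
  (m1 \x m2).-integrable setT (fun p : T1 * T2 => (h p.1 * k p.2)%:E).
Proof.
move=> ih ik.
have mh : measurable_fun setT h by apply/measurable_EFinP; exact: measurable_int ih.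
have mk : measurable_fun setT k by apply/measurable_EFinP; exact: measurable_int ik.
apply/integrableP; split.
  apply/measurable_EFinP; apply: measurable_funM.
    exact: (measurableT_comp mh).
  exact: (measurableT_comp mk).
under eq_integral do rewrite abse_EFin normrM EFinM.
rewrite (ge0_integral_tensor (h := fun x => `|h x|%:E) (k := fun x => `|k x|%:E))//.
- move: ih ik => /integrableP[_ ih] /integrableP[_ ik].
  by rewrite lte_mul_pinfty ?integral_ge0// ge0_fin_numE// integral_ge0.
- by apply/measurable_EFinP; exact: (measurableT_comp _ mh).
- by apply/measurable_EFinP; exact: (measurableT_comp _ mk).
Qed.

Lemma Rintegral_tensor (h : T1 -> R) (k : T2 -> R) :
    m1.-integrable setT (EFin \o h) -> m2.-integrable setT (EFin \o k) ->
  (\int[m1 \x m2]_p (h p.1 * k p.2) = \int[m1]_x h x * \int[m2]_y k y)%R.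
Proof.
move=> ih ik; rewrite /Rintegral -integral12_prod_meas1; last exact: integrable_tensor.
rewrite /fubini_F /=.
transitivity (fine (\int[m1]_x ((h x)%:E * \int[m2]_y (k y)%:E))).
  congr fine; apply: eq_integral => x _.
  by rewrite -integralZl//; apply: eq_integral => y _; rewrite EFinM.
have fk : \int[m2]_y (k y)%:E \is a fin_num by exact: integrable_fin_num.
rewrite -{1}(fineK fk) integralZr//= fineM//.
exact: integrable_fin_num.
Qed.

End tensor.

(** * Complex-valued integrals through their real and imaginary parts *)

Section complex_parts.
Variable R : realType.
Local Open Scope ring_scope.

Lemma complex_ReM (x y : R[i]) :
  complex.Re (x * y) = complex.Re x * complex.Re y - complex.Im x * complex.Im y.
Proof. by case: x y => [? ?] [? ?]. Qed.

Lemma complex_ImM (x y : R[i]) :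
  complex.Im (x * y) = complex.Re x * complex.Im y + complex.Im x * complex.Re y.
Proof. by case: x y => [? ?] [? ?]. Qed.

Lemma complex_ReZ (x : R) (y : R[i]) : complex.Re (x%:C%C * y) = x * complex.Re y.
Proof. by rewrite complex_ReM /= mul0r subr0. Qed.

Lemma complex_ImZ (x : R) (y : R[i]) : complex.Im (x%:C%C * y) = x * complex.Im y.
Proof. by rewrite complex_ImM /= mul0r addr0. Qed.

End complex_parts.

Section transport.
Context d d1 d2 (X : measurableType d) (Y1 : measurableType d1)
  (Y2 : measurableType d2) (R : realType).
Variables (mu : {measure set X -> \bar R})
  (nu1 : {sigma_finite_measure set Y1 -> \bar R})
  (nu2 : {sigma_finite_measure set Y2 -> \bar R}).
Variables (D : set X) (T : Y1 * Y2 -> X) (w : Y1 * Y2 -> R).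
Hypothesis w0 : forall y, (0 <= w y)%R.
Hypothesis transport : forall G : X -> \bar R,
  measurable_fun setT G -> (forall x, 0 <= G x)%E ->
  (\int[mu]_(x in D) G x = \int[nu1 \x nu2]_y ((w y)%:E * G (T y)))%E.

Let integral_transport (phi : X -> R) : measurable_fun setT phi ->
  (\int[mu]_(x in D) (phi x)%:E =
   \int[nu1 \x nu2]_y ((w y)%:E * (phi (T y))%:E))%E.
Proof.
move=> mphi; rewrite integralE [RHS]integralE; congr (_ - _)%E.
  rewrite transport//; last first.
    by apply: measurable_funepos; exact/measurable_EFinP.
  by apply: eq_integral => y _; rewrite !funeposE -!EFin_max -EFinM maxr_pMr// mulr0.
rewrite transport//; last first.
  by apply: measurable_funeneg; exact/measurable_EFinP.
by apply: eq_integral => y _; rewrite !funenegE -!EFinN -!EFin_max -EFinM maxr_pMr// mulr0 mulrN.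
Qed.

Let integrable_transport (phi : X -> R) : measurable_fun setT phi ->
  (nu1 \x nu2)%E.-integrable setT (fun y => (w y * phi (T y))%:E) ->
  mu.-integrable D (EFin \o phi).
Proof.
move=> mphi /integrableP[_ ioo]; apply/integrableP; split.
  by apply/measurable_EFinP; exact: measurable_funTS.
rewrite /= (transport (G := fun x => `|(phi x)%:E|%E))//; last first.
  by apply: measurableT_comp => //; exact/measurable_EFinP.
apply: le_lt_trans ioo; rewrite le_eqVlt; apply/orP; left; apply/eqP.
by apply: eq_integral => y _; rewrite EFinM abseM (@gee0_abs _ (w y)%:E)// lee_fin.
Qed.

(** The hypothesis [transport] concerns nonnegative functions only. It extends to real functions by
    positive and negative parts, which commute with multiplication by [w] since [w] is nonnegative,
    and to [f] by real and imaginary parts. Once the transported integrand factors, each part is a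
    combination of products in separate variables. Both the Schur recursion and the Beta integral
    use this form. *)
Lemma cintegral_transport (f : X -> R[i]) (f1 : Y1 -> R[i]) (f2 : Y2 -> R[i]) :
    measurable_fun setT (fun x => complex.Re (f x)) ->
    measurable_fun setT (fun x => complex.Im (f x)) ->
    cintegrable nu1 setT f1 -> cintegrable nu2 setT f2 ->
    (forall y, (w y)%:C%C * f (T y) = f1 y.1 * f2 y.2) ->
  cintegrable mu D f /\
  cintegral mu D f = cintegral nu1 setT f1 * cintegral nu2 setT f2.
Proof.
move=> mRe mIm [i1R i1I] [i2R i2I] ff.
have ReE y : (w y * complex.Re (f (T y)) = complex.Re (f1 y.1) * complex.Re (f2 y.2)
    - complex.Im (f1 y.1) * complex.Im (f2 y.2))%R by rewrite -complex_ReZ ff complex_ReM.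
have ImE y : (w y * complex.Im (f (T y)) = complex.Re (f1 y.1) * complex.Im (f2 y.2)
    + complex.Im (f1 y.1) * complex.Re (f2 y.2))%R by rewrite -complex_ImZ ff complex_ImM.
have iRR := integrable_tensor i1R i2R.
have iII := integrable_tensor i1I i2I.
have iRI := integrable_tensor i1R i2I.
have iIR := integrable_tensor i1I i2R.
split; [split|].
- apply: (integrable_transport mRe).
  under eq_fun do rewrite /= ReE EFinB.
  exact: (integrableB measurableT iRR iII).
- apply: (integrable_transport mIm).
  under eq_fun do rewrite /= ImE EFinD.
  exact: (integrableD measurableT iRI iIR).
rewrite /cintegral; apply/eqP; rewrite eq_complex complex_ReM complex_ImM /=.
apply/andP; split; apply/eqP.
  rewrite -!Rintegral_tensor// -RintegralB// /Rintegral.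
  rewrite (integral_transport mRe); congr fine; apply: eq_integral => y _.
  by rewrite -EFinM ReE.
rewrite -!Rintegral_tensor// -RintegralD// /Rintegral.
rewrite (integral_transport mIm); congr fine; apply: eq_integral => y _.
by rewrite -EFinM ImE.
Qed.

End transport.

Section indicator.
Context d (X : measurableType d) (R : realType) (mu : {measure set X -> \bar R}).
Variables (D : set X) (mD : measurable D) (f : X -> R[i]).

Let ReE : (fun x => (complex.Re ((\1_D x)%:C%C * f x))%:E) =
  (fun x => (complex.Re (f x))%:E) \_ D.
Proof.
apply/funext => x; rewrite complex_ReZ indicE patchE.
by case: (x \in D); rewrite ?mul1r ?mul0r.
Qed.

Let ImE : (fun x => (complex.Im ((\1_D x)%:C%C * f x))%:E) =
  (fun x => (complex.Im (f x))%:E) \_ D.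
Proof.
apply/funext => x; rewrite complex_ImZ indicE patchE.
by case: (x \in D); rewrite ?mul1r ?mul0r.
Qed.

Lemma cintegrable_indic :
  cintegrable mu setT (fun x => (\1_D x)%:C%C * f x) <-> cintegrable mu D f.
Proof. by rewrite /cintegrable ReE ImE -!integrable_mkcond. Qed.

Lemma cintegral_indic :
  cintegral mu setT (fun x => (\1_D x)%:C%C * f x) = cintegral mu D f.
Proof. by rewrite /cintegral /Rintegral ReE ImE -!integral_mkcond. Qed.

End indicator.

(** * Lebesgue measure on tuples *)

Lemma sqr_lt1 (R : realDomainType) (t : R) : `|t| < 1 -> 0 < 1 - t ^+ 2.
Proof. by move=> t1; rewrite subr_gt0 -real_normK ?num_real// expr_lt1. Qed.

Section tuple_measure.
Context (R : realType).
Local Notation RT := (measurableTypeR R).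
Local Notation mu := (@lebesgue_measure R).
Local Open Scope ereal_scope.

Lemma measurable_rcons d (T : measurableType d) n (f : T -> n.-tuple RT) (g : T -> RT) :
  measurable_fun setT f -> measurable_fun setT g ->
  measurable_fun setT (fun x => [tuple of rcons (f x) (g x)] : n.+1.-tuple RT).
Proof.
move=> mf mg; apply/measurable_fun_tnthP => i.
have [lt_in|ge_in] := ltnP i n.
  rewrite (_ : _ \o _ = fun x => tnth (f x) (Ordinal lt_in)).
    exact: (measurableT_comp (@measurable_tnth _ RT n (Ordinal lt_in)) mf).
  apply/funext => x /=.
  by rewrite !(tnth_nth (g x)) /= nth_rcons size_tuple lt_in.
rewrite (_ : _ \o _ = g)//; apply/funext => x /=.
rewrite (tnth_nth (g x)) /= nth_rcons size_tuple ltnNge ge_in /=.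
by rewrite (_ : i == n :> nat)//; apply/eqP/anti_leq; rewrite ge_in -ltnS ltn_ord.
Qed.

Lemma integral_cons n (F : n.+1.-tuple RT -> \bar R) :
    measurable_fun setT F -> (forall a, 0 <= F a) ->
  \int[lebesgue_tuple R n.+1]_a F a =
  \int[mu]_x \int[lebesgue_tuple R n]_b F [tuple of x :: b].
Proof.
move=> mF F0.
transitivity (\int[mu \x lebesgue_tuple R n]_p F (cons_pair p)).
  rewrite /=.
  exact: (ge0_integral_pushforward (@measurable_cons_pair R n)
    (mu \x lebesgue_tuple R n) measurableT).
rewrite fubini_tonelli1//.
exact: (measurableT_comp mF (@measurable_cons_pair R n)).
Qed.

(** The measure is built by adding coordinates in front, while the Schur parameter is the last
    coefficient. By induction the last coordinate of the tail is split off, and Tonelli moves it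
    past the first one. *)
Lemma integral_rcons n (F : n.+1.-tuple RT -> \bar R) :
    measurable_fun setT F -> (forall a, 0 <= F a) ->
  \int[lebesgue_tuple R n.+1]_a F a =
  \int[mu]_x \int[lebesgue_tuple R n]_b F [tuple of rcons b x].
Proof.
elim: n F => [|n IH] F mF F0.
  etransitivity; first exact: integral_cons.
  apply: eq_integral => x _; apply: eq_integral => b _.
  by congr F; apply/val_inj; rewrite /= (tuple0 b).
etransitivity; first exact: integral_cons.
have mcF x : measurable_fun setT (fun b : n.+1.-tuple RT => F [tuple of x :: b]).
  by apply: (measurableT_comp mF); apply: measurable_cons.
etransitivity.
  by apply: eq_integral => x _; exact: (IH (fun b => F [tuple of x :: b])).
have mG : measurable_fun setT (fun p : RT * RT * n.-tuple RT =>
    F [tuple of p.1.1 :: [tuple of rcons p.2 p.1.2]]).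
  apply: (measurableT_comp mF); apply: measurable_cons => //=.
    exact: measurableT_comp.
  by apply: measurable_rcons => //; exact: measurableT_comp.
have mH := measurable_fun_fubini_tonelli_F (m2 := lebesgue_tuple R n) _ mG (fun=> F0 _).
etransitivity.
  by apply: (fubini_tonelli _ mH) => p; exact: integral_ge0.
apply: eq_integral => y _; apply/esym; etransitivity.
  apply: integral_cons => //.
  by apply: (measurableT_comp mF); apply: measurable_rcons.
apply: eq_integral => x _; apply: eq_integral => b _.
by congr F; apply/val_inj.
Qed.

Lemma measurable_tupleP d (T : measurableType d) n (f : T -> n.-tuple RT) :
  (forall i, measurable_fun setT (fun x => tnth (f x) i)) -> measurable_fun setT f.
Proof. by move=> mf; apply/measurable_fun_tnthP => i; exact: mf. Qed.

Lemma measurable_funtnth d (T : measurableType d) n (f : T -> n.-tuple RT) i :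
  measurable_fun setT f -> measurable_fun setT (fun x => tnth (f x) i : R).
Proof. by move=> mf; exact: (measurableT_comp (@measurable_tnth _ RT n i) mf). Qed.

(** Two affine substitutions in one variable: v = y + t x with x fixed, which gives x + t y = (1 -
    t^2) x + t v, then u = (1 - t^2) x + t v with v fixed. The second one produces the determinant 1
    - t^2. *)
Lemma integral_symm_shear (t : R) (K : RT * RT -> \bar R) : (`|t| < 1)%R ->
    measurable_fun setT K -> (forall p, 0 <= K p) ->
  (1 - t ^+ 2)%:E * \int[mu]_x \int[mu]_y K (x + t * y, y + t * x)%R =
  \int[mu]_u \int[mu]_v K (u, v).
Proof.
move=> t1 mK K0.
have t2 := sqr_lt1 t1.
have mlin (a b : R) : measurable_fun setT (fun p : RT * RT => (a * p.1 + b * p.2)%R : RT).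
  by apply: measurable_funD; apply: measurable_funM => //.
have mshear (a b c e : R) : measurable_fun setT
    (fun p : RT * RT => K (a * p.1 + b * p.2, c * p.1 + e * p.2)%R).
  by apply: (measurableT_comp mK); apply/measurable_fun_pairP; split; exact: mlin.
have sec1 (f : RT * RT -> \bar R) (x : RT) : measurable_fun setT f ->
    measurable_fun setT (fun y : RT => f (x, y)).
  by exact: measurable_fun_pair2.
(* The second argument is just v; it is written as a linear form in both variables so that [mshear]
   gives its measurability. *)
transitivity ((1 - t ^+ 2)%:E *
    \int[mu]_x \int[mu]_v K ((1 - t ^+ 2) * x + t * v, 0 * x + 1 * v)%R).
  congr (_ * _); apply: eq_integral => x _.
  rewrite (@ge0_integral_affine R 1 (t * x) (fun v => K (_ * x + t * v, _ + 1 * v)%R))//.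
    apply: eq_integral => y _; rewrite mul1e; congr (K (_, _)); ring.
  exact: (sec1 _ x (mshear (1 - t ^+ 2) t 0 1)%R).
rewrite (fubini_tonelli (fun p : RT * RT => K (_ * p.1 + t * p.2, _ * p.1 + _ * p.2)%R))//=.
rewrite -ge0_integralZl//; last 2 first.
- by move=> v _; exact: integral_ge0.
- by rewrite lee_fin ltW.
rewrite [RHS](fubini_tonelli K)//; apply: eq_integral => v _.
rewrite [RHS](@ge0_integral_affine R (1 - t ^+ 2) (t * v))//; last first.
  exact: (measurable_fun_pair1 v mK).
rewrite ge0_integralZl//.
- by congr (_ * _); apply: eq_integral => x _; congr (K (_, _)); ring.
- apply: (measurableT_comp mK); apply/measurable_fun_pairP; split => //.
  exact: measurable_affine.
  exact: measurable_cst.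
by rewrite lee_fin ltW.
exact: (measurable_fun_fubini_tonelli_G _ (mshear (1 - t ^+ 2) t 0 1)%R).
Qed.

(* The coefficients of x P + t P^rev, except the constant one, when b lists those of P. *)
Definition twist n (t : R) (b : n.-tuple RT) : n.-tuple RT :=
  [tuple (tnth b i + t * tnth b (rev_ord i))%R | i < n].

(** The determinant of I + tJ: each pair of exchanged coordinates contributes (1 + t)(1 - t), and
    the middle coordinate, fixed by J when n is odd, contributes 1 + t. *)
Definition twist_jacobian n (t : R) : R :=
  ((1 - t ^+ 2) ^+ n./2 * (1 + t) ^+ odd n)%R.

(** Reversal exchanges the two end coordinates and reverses the inner tuple, so the map is block
    diagonal: a symmetric shear on the ends and the same map, two dimensions lower, inside. *)
Lemma twist_cons_rcons n t x (b : n.-tuple RT) y :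
  twist t [tuple of x :: [tuple of rcons b y]] =
  [tuple of (x + t * y)%R :: [tuple of rcons (twist t b) (y + t * x)%R]].
Proof.
apply: eq_from_tnth => i; rewrite tnth_mktuple.
have tnth_ends (u v : R) (c : n.-tuple RT) (j : 'I_n.+2) :
    tnth [tuple of u :: [tuple of rcons c v]] j =
    if val j == 0%N then u else if val j == n.+1 then v else nth 0%R c j.-1.
  rewrite (tnth_nth 0%R) /=; case: j => [[|j] jn] //=.
  rewrite nth_rcons size_tuple eqSS; case: ltngtP => // nj.
  by rewrite nth_default// size_tuple ltnW.
rewrite !tnth_ends /=; case: i => [[|i] i_lt] /=.
  by rewrite subn1 eqxx.
rewrite !subSS eqSS; have [->|ni] := eqVneq i n; first by rewrite subnn.
have {ni i_lt} i_lt : (i < n)%N by rewrite ltn_neqAle ni -ltnS.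
rewrite subn_eq0 leqNgt i_lt /= (_ : (n - i == n.+1)%N = false); last by lia.
rewrite -(tnth_nth _ (twist t b) (Ordinal i_lt)) tnth_mktuple.
by rewrite !(tnth_nth 0%R) /= (_ : (n - i).-1 = n - i.+1)%N// subnS.
Qed.

Lemma measurable_twist d (T : measurableType d) n (f : T -> n.-tuple RT) (t : T -> RT) :
  measurable_fun setT t -> measurable_fun setT f ->
  measurable_fun setT (fun x => twist (t x) (f x)).
Proof.
move=> mt mf; apply: measurable_tupleP => i.
under eq_fun do rewrite tnth_mktuple.
apply: measurable_funD; first exact: measurable_funtnth.
by apply: measurable_funM => //; exact: measurable_funtnth.
Qed.

(** Induction in steps of two: [integral_symm_shear] handles the end coordinates and the induction
    hypothesis the inner ones. In dimension 1 the map is multiplication by 1 + t. *)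
Lemma integral_twist n (t : R) (F : n.-tuple RT -> \bar R) : (`|t| < 1)%R ->
    measurable_fun setT F -> (forall b, 0 <= F b) ->
  (twist_jacobian n t)%:E * \int[lebesgue_tuple R n]_b F (twist t b) =
  \int[lebesgue_tuple R n]_b F b.
Proof.
move=> t1; have t2 := sqr_lt1 t1.
have t3 : (0 < 1 + t)%R by move: t1; rewrite ltr_norml => /andP[? _]; lra.
elim/ltn_ind: n F => -[|[|n]] IH F mF F0.
- rewrite /twist_jacobian /= !expr0 mulr1 mul1e; apply: eq_integral => b _.
  by rewrite (tuple0 b) (tuple0 (twist t [tuple])).
- have mFt : measurable_fun setT (fun b => F (twist t b)).
    by apply: (measurableT_comp mF); exact: measurable_twist.
  rewrite /twist_jacobian /= expr0 mul1r expr1 !integral_cons//.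
  pose G (x : RT) := \int[lebesgue_tuple R 0]_b F [tuple of x :: b].
  have mG : measurable_fun setT G.
    apply: (measurable_fun_fubini_tonelli_F (fun p : RT * 0.-tuple RT => F [tuple of p.1 :: p.2])) => //.
    by apply: (measurableT_comp mF); exact: measurable_cons.
  have G0 x : 0 <= G x by exact: integral_ge0.
  have mGa : measurable_fun setT (fun x : RT => G ((1 + t) * x + 0)%R).
    exact: (measurableT_comp mG (measurable_affine _ _)).
  apply/esym; etransitivity; first exact: (ge0_integral_affine 0 t3 mG G0).
  etransitivity.
    by apply: (ge0_integralZl mu measurableT mGa) => //; rewrite lee_fin ltW.
  congr (_ * _); apply: eq_integral => x _; apply: eq_integral => b _; congr F.
  apply: eq_from_tnth => i; rewrite tnth_mktuple (ord1 i) (ord1 (rev_ord _)) /=.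
  by rewrite !tnth0; ring.
have mFt : measurable_fun setT (fun b => F (twist t b)).
  by apply: (measurableT_comp mF); exact: measurable_twist.
have mFcr : measurable_fun setT (fun p : RT * RT * n.-tuple RT =>
    F [tuple of p.1.1 :: [tuple of rcons p.2 p.1.2]]).
  apply: (measurableT_comp mF); apply: measurable_cons => //=.
    exact: measurableT_comp.
  by apply: measurable_rcons => //; exact: measurableT_comp.
pose K (p : RT * RT) := \int[lebesgue_tuple R n]_b
  F [tuple of p.1 :: [tuple of rcons b p.2]].
have K0 p : 0 <= K p by exact: integral_ge0.
have mK : measurable_fun setT K by exact: (measurable_fun_fubini_tonelli_F _ mFcr).
have split_ends H : measurable_fun setT H -> (forall b, 0 <= H b) ->
    \int[lebesgue_tuple R n.+2]_b H b = \int[mu]_x \int[mu]_y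
      \int[lebesgue_tuple R n]_b H [tuple of x :: [tuple of rcons b y]].
  move=> mH H0; etransitivity; first exact: integral_cons.
  apply: eq_integral => x _.
  apply: (integral_rcons (F := fun b => H [tuple of x :: b])) => //.
  by apply: (measurableT_comp mH); exact: measurable_cons.
apply/esym; etransitivity; first exact: (split_ends F mF F0).
rewrite -[LHS]/(\int[mu]_u \int[mu]_v K (u, v)).
etransitivity; first by apply/esym; exact: (integral_symm_shear t1 mK K0).
have -> : twist_jacobian n.+2 t = ((1 - t ^+ 2) * twist_jacobian n t)%R.
  by rewrite /twist_jacobian /= negbK exprS mulrA.
have J0 : (0 <= twist_jacobian n t)%R by rewrite mulr_ge0// exprn_ge0// ltW.
rewrite EFinM -muleA; congr (_ * _).
pose L (p : RT * RT * n.-tuple RT) := F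
  [tuple of (p.1.1 + t * p.1.2)%R :: [tuple of rcons (twist t p.2) (p.1.2 + t * p.1.1)%R]].
have mL : measurable_fun setT L.
  rewrite /L; under eq_fun do rewrite -twist_cons_rcons.
  apply: (measurableT_comp mFt); apply: measurable_cons => //=.
    exact: measurableT_comp.
  by apply: measurable_rcons => //; exact: measurableT_comp.
transitivity ((twist_jacobian n t)%:E *
    \int[mu]_x \int[mu]_y \int[lebesgue_tuple R n]_b L (x, y, b)); last first.
  congr (_ * _); apply/esym; etransitivity; first exact: (split_ends _ mFt).
  apply: eq_integral => x _; apply: eq_integral => y _.
  by apply: eq_integral => b _; rewrite twist_cons_rcons.
have mL1 := measurable_fun_fubini_tonelli_F (m2 := lebesgue_tuple R n) _ mL (fun=> F0 _).
have L1_ge0 p : 0 <= \int[lebesgue_tuple R n]_b L (p, b) by apply: integral_ge0 => b _; exact: F0.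
have mL2 := measurable_fun_fubini_tonelli_F (m2 := mu) _ mL1 L1_ge0.
apply/esym; etransitivity.
  apply/esym; apply: (ge0_integralZl mu measurableT mL2); rewrite ?lee_fin//.
  by move=> x _; apply: integral_ge0 => y _; exact: L1_ge0.
apply: eq_integral => x _; etransitivity.
  by apply/esym; apply: (ge0_integralZl mu measurableT (measurable_fun_pair2 x mL1)) => [y _|];
    [exact: L1_ge0|rewrite lee_fin].
apply: eq_integral => y _.
apply: (IH n) => //.
apply: (measurableT_comp mF); apply: measurable_cons => //.
exact: measurable_rcons.
Qed.

End tuple_measure.

(** * The Schur recursion on the roots *)

Section roots_in_disc.
Context (R : realType).
Local Notation C := (R[i]).
Local Open Scope complex_scope.
Implicit Types (z r : C) (p : {poly C}).

(** The difference of the squared moduli factors as (|z|^2 - 1)(1 - |r|^2). *)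
Lemma norm_one_sub_mulJ_le r z : `|r| <= 1 -> 1 < `|z| -> `|1 - r * z^*| <= `|z - r|.
Proof.
move=> r1 z1; rewrite -ler_sqr ?nnegrE// -subr_ge0 !sqr_normc.
rewrite !(rmorphB, rmorphM, rmorph1) /= conjcK.
have -> : (z - r) * (z^* - r^*) - (1 - r * z^*) * (1 - r^* * z) =
    (z * z^* - 1) * (1 - r * r^*) by ring.
rewrite -!sqr_normc mulr_ge0// subr_ge0; first by rewrite exprn_ege1// ltW.
by rewrite exprn_ile1.
Qed.

Definition roots_in_disc p := forall z, root p z -> `|z| <= 1.

Lemma monic_roots_in_disc p : p \is monic -> roots_in_disc p ->
  exists2 rs : seq C, p = \prod_(r <- rs) ('X - r%:P) & forall r, r \in rs -> `|r| <= 1.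
Proof.
move=> p_monic p1; have [rs] := closed_field_poly_normal p.
rewrite (monicP p_monic) scale1r => def_p; exists rs => // r r_rs.
by apply: p1; rewrite def_p root_prod_XsubC.
Qed.

Lemma horner_reciprocal (rs : seq C) z : z != 0 ->
  z ^+ size rs * (\prod_(r <- rs) ('X - r%:P)).[z^-1] = \prod_(r <- rs) (1 - r * z).
Proof.
move=> z0; rewrite horner_prod; elim: rs => [|r rs IH]; first by rewrite !big_nil mulr1.
rewrite !big_cons -IH /= exprS hornerXsubC; field.
exact: z0.
Qed.

(** Both sides factor over the roots r, and [norm_one_sub_mulJ_le] compares z - r with 1 - r z',
    where z' is the conjugate of z. This is why the reversed polynomial is evaluated at z'. *)
Lemma horner_outside_disc p z : p \is monic -> roots_in_disc p -> 1 < `|z| ->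
  p.[z] != 0 /\ `|z^* ^+ (size p).-1 * p.[(z^*)^-1]| <= `|p.[z]|.
Proof.
move=> p_monic p1 z1; split.
  by apply/negP => /p1; rewrite lt_geF.
have [rs def_p rs1] := monic_roots_in_disc p_monic p1.
have z0 : z^* != 0 by rewrite conjc_eq0 -normr_gt0 (lt_trans _ z1).
rewrite def_p size_prod_XsubC /= horner_reciprocal// horner_prod.
rewrite big_seq [in leRHS]big_seq !normr_prod; apply: ler_prod => r r_rs.
by rewrite normr_ge0 hornerXsubC norm_one_sub_mulJ_le// rs1.
Qed.

Lemma norm_coef0_le1 p : p \is monic -> roots_in_disc p -> `|p`_0| <= 1.
Proof.
move=> p_monic p1; have [rs -> rs1] := monic_roots_in_disc p_monic p1.
rewrite -horner_coef0 horner_prod big_seq normr_prod.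
apply: prodr_ile1 => r r_rs; rewrite normr_ge0 hornerXsubC sub0r normrN.
exact: rs1.
Qed.

End roots_in_disc.

(** * Real monic polynomials, the region of the theorem and its measurability *)

Section schur_recursion.
Context (R : realType).
Local Notation C := (R[i]).
Local Notation RT := (measurableTypeR R).
Local Open Scope complex_scope.

Definition cpoly n (a : n.-tuple RT) : {poly C} := map_poly (real_complex R) (monic_poly a).

Lemma size_monic_poly n (a : n.-tuple RT) : size (monic_poly a) = n.+1.
Proof.
rewrite /monic_poly size_polyDl ?size_polyXn// ltnS.
apply: leq_trans (size_sum _ _ _) _; apply/bigmax_leqP => i _.
by apply: leq_trans (size_scale_leq _ _) _; rewrite size_polyXn; move: (ltn_ord i) => ?; lia.
Qed.

Lemma monic_poly_monic n (a : n.-tuple RT) : monic_poly a \is monic.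
Proof.
apply/monicP; rewrite lead_coefE size_monic_poly /= coefD coefXn eqxx coef_sum big1 ?addr0// => i _.
by rewrite coefZ coefXn gtn_eqF ?mulr0//; move: (ltn_ord i) => ?; lia.
Qed.

Lemma cpoly_monic n (a : n.-tuple RT) : cpoly a \is monic.
Proof. by rewrite map_monic monic_poly_monic. Qed.

Lemma size_cpoly n (a : n.-tuple RT) : size (cpoly a) = n.+1.
Proof. by rewrite size_map_poly size_monic_poly. Qed.

(** The morphism [f] is left general to cover both real values, with the identity, and values at
    complex points. *)
Lemma horner_map_monic_poly (F : fieldType) (f : {rmorphism R -> F}) n (a : n.-tuple RT) z :
  (map_poly f (monic_poly a)).[z] = z ^+ n + \sum_(i < n) f (tnth a i) * z ^+ (n - i.+1).
Proof.
rewrite rmorphD /= rmorph_sum /= map_polyXn hornerD hornerXn horner_sum; congr (_ + _).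
by apply: eq_bigr => i _; rewrite linearZ /= map_polyXn hornerZ hornerXn.
Qed.

Lemma tnth_rcons_max n (b : n.-tuple R) t : tnth [tuple of rcons b t] ord_max = t.
Proof. by rewrite (tnth_nth 0) /= nth_rcons size_tuple ltnn eqxx. Qed.

Lemma tnth_rcons_widen n (b : n.-tuple R) t i :
  tnth [tuple of rcons b t] (widen_ord (leqnSn n) i) = tnth b i.
Proof. by rewrite !(tnth_nth 0) /= nth_rcons size_tuple ltn_ord. Qed.

(** The coefficients of x P + t P^rev: the constant term of x P is 0 and that of P^rev is 1, hence
    the last entry [t]. *)
Definition schur n (t : R) (b : n.-tuple RT) : n.+1.-tuple RT := [tuple of rcons (twist t b) t].

Lemma horner_map_schur (F : fieldType) (f : {rmorphism R -> F}) n t (b : n.-tuple RT) z :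
  z != 0 -> let p := map_poly f (monic_poly b) in
  (map_poly f (monic_poly (schur t b))).[z] = z * p.[z] + f t * (z ^+ n * p.[z^-1]).
Proof.
move=> z0 /=; rewrite !horner_map_monic_poly big_ord_recr /= subnn expr0 mulr1.
rewrite tnth_rcons_max; under eq_bigr => i _.
  rewrite tnth_rcons_widen tnth_mktuple rmorphD rmorphM /= mulrDl -mulrA; over.
rewrite big_split /= -mulr_sumr.
have -> : \sum_(i < n) f (tnth b i) * z ^+ (n.+1 - i.+1) =
          z * \sum_(i < n) f (tnth b i) * z ^+ (n - i.+1).
  rewrite mulr_sumr; apply: eq_bigr => i _; rewrite mulrCA -exprS.
  by congr (_ * _ ^+ _); move: (ltn_ord i) => ?; lia.
have -> : \sum_(i < n) f (tnth b (rev_ord i)) * z ^+ (n.+1 - i.+1) =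
          z ^+ n * \sum_(i < n) f (tnth b i) * z^-1 ^+ (n - i.+1).
  rewrite (reindex_inj rev_ord_inj) mulr_sumr; apply: eq_bigr => i _.
  rewrite rev_ordK mulrCA exprVn -expfB_cond; last first.
    by rewrite (negPf z0) add0n leq_subr.
  by congr (_ * _ ^+ _) => /=; move: (ltn_ord i) => ?; lia.
by rewrite !mulrDr exprVn mulfV ?expf_neq0// mulr1 exprS; ring.
Qed.

Lemma OmegaE n (a : n.-tuple RT) : Omega R n a = roots_in_disc (cpoly a).
Proof. by []. Qed.

Lemma lecR1 (x : R) : (x%:C <= 1 :> C) = (x <= 1).
Proof. exact: lecR x 1. Qed.

Lemma norm_real (x : R) : `|x%:C| = `|x|%:C :> C.
Proof. by rewrite normc_def /= expr0n addr0 sqrtr_sqr. Qed.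

Lemma horner_cpolyJ n (a : n.-tuple RT) (z : C) : (cpoly a).[z]^* = (cpoly a).[z^*].
Proof.
rewrite !horner_map_monic_poly rmorphD rmorphXn rmorph_sum /=; congr (_ + _).
by apply: eq_bigr => i _; rewrite rmorphM rmorphXn /= oppr0.
Qed.

(** With real coefficients, conjugating the point conjugates the value; the conjugates introduced by
    [horner_outside_disc] thus disappear from moduli. *)
Lemma norm_reciprocalJ n (a : n.-tuple RT) (z : C) :
  `|z^* ^+ n * (cpoly a).[(z^*)^-1]| = `|z ^+ n * (cpoly a).[z^-1]|.
Proof.
rewrite -normcJ rmorphM rmorphXn /= conjcK horner_cpolyJ.
by congr `|_ * _.[_]|; apply: (etrans (conjc_inv _)); congr _^-1; exact: conjcK.
Qed.

Lemma schur_Omega n t (b : n.-tuple RT) : `|t| < 1 ->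
  Omega R n.+1 (schur t b) <-> Omega R n b.
Proof.
move=> t1; rewrite !OmegaE.
have t1C : `|t%:C| < 1 :> C by rewrite norm_real ltcR.
have schurE z : z != 0 -> (cpoly (schur t b)).[z] =
    z * (cpoly b).[z] + t%:C * (z ^+ n * (cpoly b).[z^-1]).
  exact: (horner_map_schur (real_complex R)).
split=> in_disc z; rewrite /root => /eqP root_z;
  apply/negPn/negP; rewrite -real_ltNge// => z1;
  have z0 : z != 0 by rewrite -normr_gt0 (lt_trans _ z1).
  (* Let P(z) = 0 with |z| > 1, and w = z^n P(1/z). Then Q = x P + t P^rev takes the value t w at z,
     and its reversal takes the value w. Domination for Q gives |w| <= |t| |w|, so w = 0 and Q(z) =
     0, which is excluded outside the disc. *)
  have [/negP qz_neq0] := horner_outside_disc (cpoly_monic _) in_disc z1.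
  rewrite size_cpoly norm_reciprocalJ /= !schurE ?invr_eq0// root_z !(mulr0, add0r) invrK root_z.
  rewrite !mulr0 addr0 exprSr mulrA -(mulrA _ z) mulfV// mulr1 [leRHS]normrM.
  set w := z ^+ n * _ => le_w; apply: qz_neq0; rewrite schurE// root_z mulr0 add0r -/w.
  rewrite mulf_eq0 -(normr_eq0 w); apply/orP; right; apply/negPn; rewrite -normr_gt0 normr_id.
  apply/negP => w_gt0; move: le_w; rewrite lt_geF// gtr_pMl//.
(* Conversely, a root z of x P + t P^rev outside the disc would give |z| |P(z)| = |t| |P^rev(z)| <=
   |P(z)| with P(z) nonzero. *)
have [] := horner_outside_disc (cpoly_monic _) in_disc z1.
rewrite size_cpoly norm_reciprocalJ /= -normr_gt0 => p_gt0 le_p.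
move/eqP: root_z; rewrite schurE// addr_eq0 => /eqP /(congr1 (fun x => `|x|)).
rewrite normrN !normrM => eq_norm.
have : `|z| * `|(cpoly b).[z]| <= `|(cpoly b).[z]|.
  rewrite eq_norm; apply: le_trans le_p; rewrite normrM.
  by rewrite ler_piMl ?mulr_ge0// ltW.
by rewrite lt_geF// ltr_pMl.
Qed.

(** Up to sign, the last coefficient is the product of the roots. *)
Lemma Omega_last n (a : n.+1.-tuple RT) : Omega R n.+1 a -> `|tnth a ord_max| <= 1.
Proof.
move=> /(norm_coef0_le1 (cpoly_monic a)); rewrite -horner_coef0 horner_map_monic_poly.
rewrite exprS mul0r add0r big_ord_recr big1 /= ?add0r ?subnn ?mulr1 ?norm_real ?lecR// => i _.
by rewrite subSS expr0n subn_eq0 leqNgt ltn_ord mulr0.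
Qed.

(* The exponent -1 stands for the inverse because measurability is known for real powers. *)
Definition unschur n (c : n.+1.-tuple RT) : n.-tuple RT :=
  [tuple (1 - tnth c ord_max ^+ 2) `^ (-1) * (tnth c (widen_ord (leqnSn n) i) -
     tnth c ord_max * tnth c (widen_ord (leqnSn n) (rev_ord i))) | i < n].

(** Since J is an involution, the inverse of I + tJ is (1 - t^2)^-1 (I - tJ). *)
Lemma unschurK n (c : n.+1.-tuple RT) : `|tnth c ord_max| < 1 ->
  schur (tnth c ord_max) (unschur c) = c.
Proof.
move=> /sqr_lt1 t2; apply: eq_from_tnth => i.
case: (unliftP ord_max i) => [j ->|->]; last by rewrite tnth_rcons_max.
have -> : lift ord_max j = widen_ord (leqnSn n) j.
  by apply: val_inj; rewrite /= /bump leqNgt ltn_ord.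
rewrite tnth_rcons_widen !tnth_mktuple rev_ordK powR_inv1 ?ltW//.
by field; rewrite gt_eqF.
Qed.

Lemma measurable_unschur n : measurable_fun setT (@unschur n).
Proof.
apply: measurable_tupleP => i; under eq_fun do rewrite tnth_mktuple.
have mt j : measurable_fun setT (fun c : n.+1.-tuple RT => tnth c j : R).
  exact: measurable_funtnth.
apply: measurable_funM; last by apply: measurable_funB => //; exact: measurable_funM.
apply: (measurableT_comp (measurable_powR (-1))).
by apply: measurable_funB => //; exact: measurable_funX.
Qed.

(** The coefficients of r^n P(x / r), whose roots are r times those of P. *)
Definition dilate n (r : R) (a : n.-tuple RT) : n.-tuple RT :=
  [tuple r ^+ i.+1 * tnth a i | i < n].

Lemma measurable_dilate n r : measurable_fun setT (@dilate n r).
Proof.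
apply: measurable_tupleP => i; under eq_fun do rewrite tnth_mktuple.
by apply: measurable_funM => //; exact: measurable_funtnth.
Qed.

Lemma root_dilate n r (a : n.-tuple RT) (z : C) : r != 0 ->
  root (cpoly (dilate r a)) (r%:C * z) = root (cpoly a) z.
Proof.
move=> r0; rewrite /root; have -> : (cpoly (dilate r a)).[r%:C * z] = r%:C ^+ n * (cpoly a).[z].
  rewrite !horner_map_monic_poly exprMn mulrDr mulr_sumr; congr (_ + _).
  apply: eq_bigr => i _; rewrite tnth_mktuple rmorphM rmorphXn /= exprMn.
  rewrite -[in r%:C ^+ n](subnKC (ltn_ord i)) exprD; ring.
by rewrite mulf_eq0 expf_eq0 fmorph_eq0 (negPf r0) andbF.
Qed.

(** By [unschurK] and [schur_Omega], the points of the region with last coefficient in ]-1, 1[.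
    Stated as a preimage of the region one degree lower, the set is measurable by induction on the
    degree. *)
Definition open_Omega n : set (n.+1.-tuple RT) :=
  [set c | `|tnth c ord_max| < 1] `&` (@unschur n @^-1` Omega R n).

(* This gives measurability: shrinking the roots moves a point of Omega to where its last
   coefficient is less than 1 in absolute value, and there the recursion can be inverted. *)
Lemma Omega_bigcap n : Omega R n.+1 =
  \bigcap_k (@dilate n.+1 (k.+1%:R / k.+2%:R) @^-1` @open_Omega n).
Proof.
have r_gt0 k : 0 < k.+1%:R / k.+2%:R :> R by rewrite divr_gt0.
have r_lt1 k : k.+1%:R / k.+2%:R < 1 :> R by rewrite ltr_pdivrMr// mul1r ltr_nat.
have r0 k := lt0r_neq0 (r_gt0 k).
apply/seteqP; split=> [a Oa k _|a Da z root_z].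
  rewrite /open_Omega /=; set c := dilate _ a.
  have c1 : `|tnth c ord_max| < 1.
    rewrite tnth_mktuple normrM normrX gtr0_norm//.
    apply: (le_lt_trans (ler_piMr _ (Omega_last Oa))); first by rewrite exprn_ge0// ltW.
    by rewrite exprn_ilt1// ltW.
  split=> //; apply/(schur_Omega _ c1); rewrite unschurK// => z.
  have zE : z = (k.+1%:R / k.+2%:R)%:C * ((k.+1%:R / k.+2%:R)^-1%:C * z).
    by rewrite mulrA -rmorphM /= mulfV// mul1r.
  rewrite {1}zE root_dilate// => /Oa z1.
  rewrite zE normrM norm_real (gtr0_norm (r_gt0 k)).
  by apply: mulr_ile1 => //; [rewrite ler0c ltW|rewrite lecR1 ltW].
have z_le k : (k.+1%:R / k.+2%:R)%:C * `|z| <= 1.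
  have [c1 /(schur_Omega _ c1)] := Da k I; rewrite unschurK//.
  move=> /(_ ((k.+1%:R / k.+2%:R)%:C * z)); rewrite root_dilate// => /(_ root_z).
  by rewrite normrM norm_real (gtr0_norm (r_gt0 k)).
move: z_le; rewrite normc_def; set x := Num.sqrt _ => z_le.
have {}z_le k : k.+1%:R / k.+2%:R * x <= 1.
  by rewrite -lecR rmorphM; exact: z_le.
rewrite lecR1 leNgt; apply/negP => x1.
have x1_gt0 : 0 < x - 1 by rewrite subr_gt0.
(* Here x = |z|, and [z_le k] amounts to (k + 1)(x - 1) <= 1; this fails for k > 1 / (x - 1). *)
have := archi_boundP (ltW (divr_gt0 ltr01 x1_gt0)).
set k := Num.bound _; rewrite ltr_pdivrMr// => k_gt.
have := z_le k; rewrite mulrAC ler_pdivrMr// mul1r => kx.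
have : k.+1%:R * (x - 1) <= 1 by move: kx; rewrite -(natr1 k.+1); lra.
by apply/negP; rewrite -ltNge (lt_le_trans k_gt)// ler_pM2r// ler_nat.
Qed.

Lemma Omega0 : Omega R 0 = setT.
Proof.
apply/seteqP; split=> // a _ z; rewrite /root horner_map_monic_poly big_ord0.
by rewrite expr0 addr0 oner_eq0.
Qed.

Lemma measurable_Omega n : measurable (Omega R n).
Proof.
elim: n => [|n IH]; first by rewrite Omega0.
rewrite Omega_bigcap; apply: bigcapT_measurable => k.
rewrite -[X in measurable X]setTI; apply: measurable_dilate => //.
apply: measurableI; last by rewrite -[X in measurable X]setTI; exact: measurable_unschur.
have mlt : measurable_fun setT (fun c : n.+1.-tuple RT => `|tnth c ord_max : R| < 1).
  apply: measurable_fun_ltr => //; apply: measurableT_comp => //.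
  exact: measurable_funtnth.
by have := mlt measurableT [set true] I; rewrite setTI.
Qed.

End schur_recursion.

(** * Integration along the Schur recursion *)

Section schur_integral.
Context (R : realType).
Local Notation RT := (measurableTypeR R).
Local Notation mu := (@lebesgue_measure R).
Local Open Scope ereal_scope.

Variables (n : nat) (D : set (n.-tuple RT)) (E : set (n.+1.-tuple RT)).
Hypotheses (mD : measurable D) (mE : measurable E).
Hypothesis E_last : forall a, E a -> (`|tnth a ord_max : R| <= 1)%R.
Hypothesis E_schur : forall t b, (`|t| < 1)%R -> E (schur t b) <-> D b.

(** The indicators are part of the weight so that the transported integral extends over the whole
    product space, as [cintegral_transport] expects. *)
Definition schur_weight (p : RT * n.-tuple RT) : R :=
  (\1_(`](-1)%R, 1%R[%classic : set RT) p.1 * twist_jacobian n p.1 * \1_D p.2)%R.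

Lemma twist_jacobian_ge0 (t : R) : (`|t| < 1)%R -> (0 <= twist_jacobian n t)%R.
Proof.
move=> t1; rewrite mulr_ge0 ?exprn_ge0// ?ltW ?sqr_lt1//.
by move: t1; rewrite ltr_norml => /andP[? _]; lra.
Qed.

Lemma in_oo1 (t : R) : (t \in (`](-1)%R, 1%R[%classic : set R)) = (`|t| < 1)%R.
Proof. by rewrite mem_setE in_itv /= ltr_norml. Qed.

Lemma schur_weight_ge0 p : (0 <= schur_weight p)%R.
Proof.
rewrite /schur_weight !indicE in_oo1; case: ltP => t1; last by rewrite !mul0r.
by rewrite mul1r mulr_ge0// twist_jacobian_ge0.
Qed.

Lemma measurable_twist_jacobian : measurable_fun setT (twist_jacobian n : RT -> R).
Proof.
apply: measurable_funM; apply: measurable_funX; last exact: measurable_funD.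
by apply: measurable_funB => //; exact: measurable_funX.
Qed.

Lemma measurable_schur_weight : measurable_fun setT schur_weight.
Proof.
have mI : measurable_fun setT (\1_(`](-1)%R, 1%R[%classic : set RT) : RT -> R).
  exact: measurable_indic.
have mJ : measurable_fun setT (\1_D : n.-tuple RT -> R) by exact: measurable_indic.
apply: measurable_funM; first apply: measurable_funM.
- exact: (measurableT_comp mI).
- exact: (measurableT_comp measurable_twist_jacobian).
- exact: (measurableT_comp mJ).
Qed.

Lemma measurable_schur : measurable_fun setT (fun p : RT * n.-tuple RT => schur p.1 p.2).
Proof. by apply: measurable_rcons => //; exact: measurable_twist. Qed.

(** The last coordinate t is split off. For |t| < 1 the other coordinates are substituted by
    [integral_twist], and for |t| > 1 both inner integrals vanish by [E_last]. The sets [D] and [E]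
    are kept abstract because the formula is applied to the regular part of the region and to its
    complement in the region. *)
Lemma integral_schur (G : n.+1.-tuple RT -> \bar R) :
    measurable_fun setT G -> (forall a, 0 <= G a) ->
  \int[lebesgue_tuple R n.+1]_(a in E) G a =
  \int[mu \x lebesgue_tuple R n]_p ((schur_weight p)%:E * G (schur p.1 p.2)).
Proof.
move=> mG G0; rewrite integral_mkcond.
have mGE : measurable_fun setT (G \_ E) by exact: ((measurable_restrictT G mE).1 (measurable_funTS mG)).
have GE0 a : 0 <= (G \_ E) a by rewrite patchE; case: ifP.
have mH : measurable_fun setT (fun p : RT * n.-tuple RT =>
    (schur_weight p)%:E * G (schur p.1 p.2)).
  apply: emeasurable_funM; first (apply/measurable_EFinP; exact: measurable_schur_weight).
  exact: (measurableT_comp mG measurable_schur).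
have H0 p : 0 <= (schur_weight p)%:E * G (schur p.1 p.2).
  by rewrite mule_ge0// lee_fin schur_weight_ge0.
have mK : measurable_fun setT (fun p : RT * n.-tuple RT => (G \_ E) [tuple of rcons p.2 p.1]).
  by apply: (measurableT_comp mGE); exact: measurable_rcons.
etransitivity; first exact: (integral_rcons mGE GE0).
apply/esym; etransitivity; first exact: (fubini_tonelli1 _ mH H0).
rewrite /fubini_F /=; apply: ge0_ae_eq_integral => //.
- exact: (measurable_fun_fubini_tonelli_F _ mH H0).
- exact: (measurable_fun_fubini_tonelli_F _ mK (fun=> GE0 _)).
- by move=> t _; exact: integral_ge0.
- by move=> t _; exact: integral_ge0.
(* At t = 1 and t = -1 the weight vanishes while the fibre of [E] may carry mass; these two values
   form a null set. *)
exists [set (-1)%R; 1%R]; split.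
- by apply: measurableU; exact: measurable_set1.
- apply: countable_lebesgue_measure0; apply: finite_set_countable.
  by rewrite finite_setU; split; exact: finite_set1.
move=> t /= /not_implyP[_ neq_int].
have [t1|t1|t1] := ltgtP `|t|%R 1%R; last first.
- have [t_ge0|t_lt0] := ger0P t; first by right; rewrite -(ger0_norm t_ge0).
  by left; rewrite -[t]opprK -(ltr0_norm t_lt0) t1.
- case: neq_int; transitivity (0 : \bar R).
    apply: integral0_eq => b _; rewrite /schur_weight indicE in_oo1 ltNge (ltW t1) /=.
    by rewrite !mul0r mul0e.
  apply/esym/integral0_eq => c _; rewrite patchE memNset// => /E_last.
  by rewrite tnth_rcons_max leNgt t1.
case: neq_int.
have mKt := measurable_fun_pair2 t mK.
apply/esym; etransitivity; first by apply/esym; exact: (integral_twist t1 mKt).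
have mL : measurable_fun setT (fun b : n.-tuple RT => (G \_ E) (schur t b)).
  have mtw : measurable_fun setT (fun b : n.-tuple RT => twist t b).
    exact: measurable_twist.
  exact: (measurableT_comp mKt mtw).
etransitivity.
  apply/esym; apply: (ge0_integralZl _ measurableT mL) => //.
  by rewrite lee_fin twist_jacobian_ge0.
apply: eq_integral => b _; rewrite /schur_weight !indicE in_oo1 t1 mul1r.
rewrite patchE; have [/set_mem bD|bD] := boolP (b \in D).
  by rewrite mem_set ?mulr1//; exact/E_schur.
rewrite memNset ?mulr0 ?mul0e ?mule0// => /(E_schur _ t1) /mem_set.
exact/negP.
Qed.

End schur_integral.

(** * Complex powers of positive real numbers *)

Section complex_power.
Context (R : realType).
Implicit Types (x y : R) (s u : R[i]).
Local Open Scope complex_scope.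

Lemma cpow1 (s : R[i]) : cpow (1 : R) s = 1.
Proof. by rewrite /cpow powR1 ln1 mulr0 cos0 sin0 mul1r. Qed.

Lemma cpowM x y s : 0 < x -> 0 < y -> cpow (x * y) s = cpow x s * cpow y s.
Proof.
move=> x0 y0; rewrite /cpow powRM ?ltW// lnM ?posrE// mulrDr cosD sinD.
by apply/eqP; rewrite eq_complex /=; apply/andP; split; apply/eqP; ring.
Qed.

Lemma cpowD x s u : 0 < x -> cpow x (s + u) = cpow x s * cpow x u.
Proof.
move=> x0; rewrite /cpow !raddfD /= powRD ?(gt_eqF x0) ?implybT//.
rewrite mulrDl cosD sinD.
by apply/eqP; rewrite eq_complex /=; apply/andP; split; apply/eqP; ring.
Qed.

Lemma cpow_nat x k : 0 < x -> cpow x k%:R = (x ^+ k)%:C.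
Proof.
move=> x0; elim: k => [|k IH].
  by rewrite /cpow /= powRr0 mul0r cos0 sin0 mul1r.
rewrite -natr1 cpowD// IH /cpow /= powRr1 ?ltW// mul0r cos0 sin0.
by apply/eqP; rewrite eq_complex /=; apply/andP; split; apply/eqP; rewrite ?exprSr; ring.
Qed.

Lemma cpow0 x : 0 < x -> cpow x 0 = 1.
Proof. exact: (cpow_nat 0). Qed.

Lemma measurable_Re_cpow d (T : measurableType d) (f : T -> R) s :
  measurable_fun setT f -> measurable_fun setT (fun z => complex.Re (cpow (f z) s)).
Proof.
move=> mf; under eq_fun do rewrite complex_ReZ /=.
apply: measurable_funM; first exact: (measurableT_comp (measurable_powR _)).
apply: (measurableT_comp (continuous_measurable_fun (@continuous_cos R))).
by apply: measurable_funM => //; exact: (measurableT_comp (@measurable_ln R)).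
Qed.

Lemma measurable_Im_cpow d (T : measurableType d) (f : T -> R) s :
  measurable_fun setT f -> measurable_fun setT (fun z => complex.Im (cpow (f z) s)).
Proof.
move=> mf; under eq_fun do rewrite complex_ImZ /=.
apply: measurable_funM; first exact: (measurableT_comp (measurable_powR _)).
apply: (measurableT_comp (continuous_measurable_fun (@continuous_sin R))).
by apply: measurable_funM => //; exact: (measurableT_comp (@measurable_ln R)).
Qed.

End complex_power.

(** * The Gamma integral *)

Section positive_integral.
Context d (T : measurableType d) (R : realType) (mu : {measure set T -> \bar R}).
Local Open Scope ereal_scope.

Lemma integral_gt0 (D : set T) (f : T -> R) : measurable D ->
    measurable_fun D f -> (forall x, D x -> (0 < f x)%R) -> 0 < mu D ->
  0 < \int[mu]_(x in D) (f x)%:E.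
Proof.
move=> mD mf f_gt0 D_gt0; rewrite lt0e integral_ge0 ?andbT; last first.
  by move=> x Dx; rewrite lee_fin ltW// f_gt0.
apply/negP => /eqP int0.
have mEf : measurable_fun D (EFin \o f) by exact/measurable_EFinP.
have [+ _] := ae_eq_integral_abs mu mD mEf.
have -> : \int[mu]_(x in D) `|(EFin \o f) x| = 0.
  by rewrite -[RHS]int0; apply: eq_integral => x /set_mem Dx /=; rewrite gtr0_norm// f_gt0.
move=> /(_ erefl) [N [mN N0 DN]]; move: D_gt0; rewrite ltNge => /negP; apply.
rewrite -N0 le_measure ?inE// => x Dx; apply: DN => /= /(_ Dx) [fx0].
by have := f_gt0 _ Dx; rewrite fx0 ltxx.
Qed.

End positive_integral.

Section real_gamma.
Context (R : realType).
Local Notation RT := (measurableTypeR R).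
Local Notation mu := (@lebesgue_measure R).
Local Open Scope ring_scope.

(** The integrand is the derivative of t^a. On [1/(i+2), 1], away from the possible singularity at
    0, the integral is 1 - (i+2)^-a <= 1, and these intervals increase to ]0, 1]. *)
Lemma integral_powR_le1 (a : R) : 0 < a ->
  (\int[mu]_(t in `]0%R, 1%R]) (a * t `^ (a - 1))%:E <= 1)%E.
Proof.
move=> a0.
pose F (i : nat) : set R := `[(i.+2%:R^-1 : R), 1]%classic.
have -> : `]0%R, 1%R]%classic = \bigcup_i F i :> set R.
  apply/seteqP; split => t /=.
    rewrite in_itv /= => /andP[t0 t1].
    have /= := archi_boundP (ltW (divr_gt0 ltr01 t0)).
    set i := Num.bound _ => it; exists i => //.
    rewrite /F /= in_itv /= t1 andbT -[t]invrK lef_pV2 ?posrE ?invr_gt0//.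
    apply: le_trans (ltW _) _; first by rewrite -[t^-1]mul1r; exact: it.
    by rewrite ler_nat; lia.
  move=> [i _]; rewrite /F /= !in_itv /= => /andP[it ->]; rewrite andbT.
  exact: lt_le_trans it.
have in_pos i (t : R) : i.+2%:R^-1 <= t -> t \in `]0, +oo[.
  by move=> it; rewrite in_itv /= andbT; exact: lt_le_trans it.
have continuous_pow (b t : R) : t \in `]0, +oo[ -> {for t, continuous (fun t : R => t `^ b)}.
  move=> t0; apply/differentiable_continuous/derivable1_diffP; exact: derivable_powR.
have F_le i : (\int[mu]_(t in F i) (a * t `^ (a - 1))%:E <= 1)%E.
  rewrite (@continuous_FTC2 _ _ (fun t => t `^ a)).
  - by rewrite -EFinB lee_fin powR1 lerBlDr lerDl powR_ge0.
  - by rewrite invf_lt1// ltr1n.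
  - apply: derivable_within_continuous => t; rewrite in_itv /= => /andP[it _].
    by apply: derivableM => //; apply: derivable_powR; exact: in_pos it.
  - split=> [t|/=|/=].
    + rewrite in_itv /= => /andP[it _]; apply: derivable_powR.
      exact: (in_pos i _ (ltW it)).
    + by apply/cvg_at_right_filter/continuous_pow/(in_pos i).
    + by apply/cvg_at_left_filter/continuous_pow; rewrite in_itv /= andbT.
  - move=> t; rewrite in_itv /= => /andP[it _]; apply: powR_derive1.
    exact: (in_pos i _ (ltW it)).
have mp : measurable_fun setT (fun t : RT => (a * t `^ (a - 1))%:E).
  by apply/measurable_EFinP; apply: measurable_funM => //; exact: measurable_powR.
have ndF : nondecreasing_seq F.
  apply/nondecreasing_seqP => n; apply/subsetPset => t; rewrite /F /= !in_itv /= => /andP[nt ->].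
  by rewrite andbT (le_trans _ nt)// lef_pV2 ?posrE// ler_nat.
have := @ge0_nondecreasing_set_cvg_integral _ RT _ F (fun t => (a * t `^ (a - 1))%:E) mu
  ndF (fun=> measurable_itv _) (fun=> measurable_funTS mp).
have a_ge0 k t : F k t -> (0 <= (a * t `^ (a - 1))%:E)%E.
  by move=> _; rewrite lee_fin mulr_ge0 ?powR_ge0// ltW.
by move=> /(_ a_ge0); apply: cvge_le; exact: nearW.
Qed.

Lemma integrable_powR (a : R) : 0 < a ->
  mu.-integrable `]0, 1] (fun t : RT => (t `^ (a - 1))%:E).
Proof.
move=> a0; have iaF : mu.-integrable `]0, 1] (fun t : RT => (a * t `^ (a - 1))%:E).
  apply/integrableP; split.
    apply/measurable_EFinP; apply: measurable_funM => //.
    by apply: measurable_funTS; exact: measurable_powR.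
  rewrite (eq_integral (fun t : RT => (a * t `^ (a - 1))%:E)); last first.
    by move=> t _; rewrite gee0_abs// lee_fin mulr_ge0 ?powR_ge0// ltW.
  exact: le_lt_trans (integral_powR_le1 a0) (ltry _).
have := integrableZl (measurable_itvRT _) a^-1 iaF.
by apply: eq_integrable => // t _; rewrite -EFinM mulrA mulVf ?gt_eqF// mul1r.
Qed.

Definition gamma_fun (a t : R) : R := t `^ (a - 1) * expR (- t).

Lemma gamma_fun_ge0 a t : 0 <= gamma_fun a t.
Proof. by rewrite mulr_ge0 ?powR_ge0 ?expR_ge0. Qed.

Lemma gamma_fun_gt0 a t : 0 < t -> 0 < gamma_fun a t.
Proof. by move=> t0; rewrite mulr_gt0 ?powR_gt0 ?expR_gt0. Qed.

Lemma measurable_gamma_fun a : measurable_fun setT (gamma_fun a : RT -> R).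
Proof.
apply: measurable_funM; first exact: measurable_powR.
by apply: (measurableT_comp (f := expR)); [exact: measurable_expR|exact: measurable_funN].
Qed.

(** With a <= m + 1, the power is at most t^(m+1), and (t/2)^(m+1) / (m+1)! is a single term of the
    series of e^(t/2). *)
Lemma powR_expR_bound (a : R) : exists2 C : R, 0 <= C &
  forall t, 1 <= t -> t `^ a <= C * expR (t / 2).
Proof.
pose m := Num.bound a.
have am : a <= m.+1%:R.
  have [a0|/ltW a0] := leP 0 a; last by apply: le_trans a0 _.
  by apply: le_trans (ltW (archi_boundP a0)) _; rewrite ler_nat.
exists (2 ^+ m.+1 * m.+1`!%:R); first by rewrite mulr_ge0// exprn_ge0.
move=> t t1; have t0 : 0 <= t by apply: le_trans t1.
apply: (le_trans (ler_powR t1 am)); rewrite powR_mulrn//.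
have := expR_ge1Dxn m (divr_ge0 t0 (ler0n R 2)).
have fact_gt : 0 < m.+1`!%:R :> R by rewrite ltr0n fact_gt0.
move=> le_exp; have {le_exp} : (t / 2) ^+ m.+1 / m.+1`!%:R <= expR (t / 2) by lra.
rewrite ler_pdivrMr// expr_div_n ler_pdivrMr ?exprn_gt0// => /le_trans; apply.
by rewrite le_eqVlt; apply/orP; left; apply/eqP; ring.
Qed.

(** Dominated by t^(a-1) on ]0, 1] and by C e^(-t/2) beyond 1; the latter is 2C times the
    exponential density of rate 1/2, whose integrability is known. *)
Lemma integrable_gamma (a : R) : 0 < a ->
  mu.-integrable `]0, +oo[ (EFin \o gamma_fun a).
Proof.
move=> a0; have [C C0 leC] := powR_expR_bound (a - 1).
pose A (t : R) := ((fun t : R => t `^ (a - 1)) \_ `]0, 1]) t.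
pose B (t : R) := 2 * C * exponential_pdf (2^-1 : R) t.
have iA : mu.-integrable setT (EFin \o A).
  have /(integrable_mkcond _ (measurable_itvRT _)) := integrable_powR a0.
  by rewrite (_ : _ \_ _ = EFin \o A)// restrict_EFin.
have iB : mu.-integrable setT (EFin \o B).
  have rate_gt0 : 0 < 2^-1 :> R by rewrite invr_gt0.
  have := integrableZl measurableT (2 * C) (integrable_exponential_pdf rate_gt0).
  by apply: eq_integrable => // t _; rewrite /= -EFinM.
have := integrableS measurableT (measurable_itvRT `]0%R, +oo[) (subsetT _) (integrableD measurableT iA iB).
apply: le_integrable => //.
  apply/measurable_EFinP; apply: measurable_funTS; exact: measurable_gamma_fun.
move=> t; rewrite /= in_itv /= andbT => t0.
have B0 : 0 <= B t by rewrite !mulr_ge0// exponential_pdf_ge0// invr_ge0.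
have A0 : 0 <= A t by rewrite /A patchE; case: ifP => // _; exact: powR_ge0.
rewrite lee_fin ger0_norm ?gamma_fun_ge0// ger0_norm ?addr_ge0//.
have [t1|t1] := leP t 1.
  apply: (@le_trans _ _ (A t)); last by rewrite lerDl.
  rewrite /A patchE mem_set; last by rewrite /= in_itv /= t0.
  by rewrite ler_piMr ?powR_ge0// -[leRHS]expR0 ler_expR oppr_le0 ltW.
apply: (@le_trans _ _ (B t)); last by rewrite lerDr.
rewrite /B (exponential_pdfE _ (ltW t0)) /gamma_fun.
apply: (le_trans (ler_wpM2r (expR_ge0 (- t)) (leC t (ltW t1)))).
rewrite -[leLHS]mulrA -expRD le_eqVlt; apply/orP; left; apply/eqP.
by rewrite (_ : t / 2 - t = - 2^-1 * t); [field|field].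
Qed.

End real_gamma.

(** * The Beta integral *)

Section complex_integrability.
Context d (T : measurableType d) (R : realType) (mu : {measure set T -> \bar R}).
Variables (D : set T) (mD : measurable D).
Local Notation normc := ComplexField.Normc.normc.

Lemma norm_Re_le (z : R[i]) : `|complex.Re z| <= normc z.
Proof. by case: z => x y /=; rewrite -sqrtr_sqr ler_wsqrtr// lerDl sqr_ge0. Qed.

Lemma norm_Im_le (z : R[i]) : `|complex.Im z| <= normc z.
Proof. by case: z => x y /=; rewrite -sqrtr_sqr ler_wsqrtr// lerDr sqr_ge0. Qed.

Lemma normc_ge0 (z : R[i]) : 0 <= normc z.
Proof. by case: z => x y; exact: sqrtr_ge0. Qed.

Lemma normc_real (x : R) : normc x%:C%C = `|x|.
Proof. by rewrite /= expr0n addr0 sqrtr_sqr. Qed.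

Lemma normc_mul (x y : R[i]) : normc (x * y) = normc x * normc y.
Proof. exact: ComplexField.Normc.normcM. Qed.

Lemma normc_cpow (x : R) (s : R[i]) : normc (cpow x s) = x `^ complex.Re s.
Proof.
by rewrite normc_mul normc_real /= cos2Dsin2 sqrtr1 mulr1 ger0_norm ?powR_ge0.
Qed.

Lemma cintegrable_le (f : T -> R[i]) (g : T -> R) :
    measurable_fun D (fun x => complex.Re (f x)) ->
    measurable_fun D (fun x => complex.Im (f x)) ->
    mu.-integrable D (EFin \o g) -> (forall x, D x -> normc (f x) <= g x) ->
  cintegrable mu D f.
Proof.
move=> mRe mIm ig fg; split; (apply: (le_integrable mD _ _ ig); first exact/measurable_EFinP);
  move=> x Dx /=; rewrite lee_fin;
  apply: le_trans (le_trans (fg x Dx) (ler_norm _)).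
  exact: norm_Re_le.
exact: norm_Im_le.
Qed.

Lemma cintegralZl (c : R[i]) (f : T -> R[i]) : cintegrable mu D f ->
  cintegrable mu D (fun x => c * f x) /\
  cintegral mu D (fun x => c * f x) = c * cintegral mu D f.
Proof.
move=> [iRe iIm].
have iZRe r : mu.-integrable D (EFin \o (fun x => r * complex.Re (f x))).
  by have := integrableZl mD r iRe; apply: eq_integrable => // x _; rewrite -EFinM.
have iZIm r : mu.-integrable D (EFin \o (fun x => r * complex.Im (f x))).
  by have := integrableZl mD r iIm; apply: eq_integrable => // x _; rewrite -EFinM.
split; [split|].
- have := integrableB mD (iZRe (complex.Re c)) (iZIm (complex.Im c)).
  by apply: eq_integrable => // x _; rewrite /= complex_ReM EFinB.
- have := integrableD mD (iZIm (complex.Re c)) (iZRe (complex.Im c)).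
  by apply: eq_integrable => // x _; rewrite /= complex_ImM EFinD.
rewrite /cintegral; apply/eqP; rewrite eq_complex complex_ReM complex_ImM /=.
apply/andP; split; apply/eqP.
  by rewrite -!RintegralZl// -RintegralB//; apply: eq_Rintegral => x _; rewrite complex_ReM.
by rewrite -!RintegralZl// -RintegralD//; apply: eq_Rintegral => x _; rewrite complex_ImM.
Qed.

End complex_integrability.

Section beta.
Context (R : realType).
Local Notation RT := (measurableTypeR R).
Local Notation mu := (@lebesgue_measure R).
Local Notation normc := ComplexField.Normc.normc.
Local Notation pos := (`]0%R, +oo[%classic : set RT).
Local Notation unit_ball := (`](-1)%R, 1%R[%classic : set RT).
Local Open Scope complex_scope.

Definition gammaC (z : R[i]) (t : RT) : R[i] := cpow t (z - 1) * (expR (- t))%:C.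

Definition betaC (a b : R[i]) (t : RT) : R[i] := cpow (1 + t) (a - 1) * cpow (1 - t) (b - 1).

(** With q = (s, t), the point (s (1 + t) / 2, s (1 - t) / 2). The second component is written s -
    x, x being the first, so that the map is visibly a composite of affine substitutions in one
    variable. *)
Definition polar (q : RT * RT) : RT * RT :=
  (q.1 / 2 * q.2 + q.1 / 2, q.1 - (q.1 / 2 * q.2 + q.1 / 2)).

Definition polar_weight (q : RT * RT) : R :=
  \1_pos q.1 * (q.1 / 2) * \1_unit_ball q.2.

Lemma measurable_polar : measurable_fun setT polar.
Proof.
have mh : measurable_fun setT (fun q : RT * RT => q.1 / 2 : RT) by exact: measurable_funM.
have mx : measurable_fun setT (fun q : RT * RT => q.1 / 2 * q.2 + q.1 / 2 : RT).
  by apply: measurable_funD => //; exact: measurable_funM.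
by apply/measurable_fun_pairP; split => //; exact: measurable_funB.
Qed.

Lemma measurable_polar_weight : measurable_fun setT polar_weight.
Proof.
have mI (A : set RT) : measurable A -> measurable_fun setT (\1_A : RT -> R).
  by move=> mA; exact: measurable_indic.
have mh : measurable_fun setT (fun q : RT * RT => q.1 / 2 : RT) by exact: measurable_funM.
apply: measurable_funM; first apply: measurable_funM => //.
  exact: (measurableT_comp (mI _ (measurable_itvRT _)) measurable_fst).
exact: (measurableT_comp (mI _ (measurable_itvRT _)) measurable_snd).
Qed.

Lemma polar_weight_ge0 q : 0 <= polar_weight q.
Proof.
rewrite /polar_weight !indicE mem_setE in_itv /= andbT.
case: ltP => q0; last by rewrite !mul0r.
by rewrite mul1r mulr_ge0// divr_ge0 ?ler0n// ltW.
Qed.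

Lemma polar_domain q : 0 < q.1 -> (pos `*` pos) (polar q) <-> unit_ball q.2.
Proof.
move=> q0; rewrite /= !in_itv /= !andbT.
have q2 : 0 < q.1 / 2 by rewrite divr_gt0.
have -> : q.1 / 2 * q.2 + q.1 / 2 = q.1 / 2 * (1 + q.2) by ring.
have -> : q.1 - q.1 / 2 * (1 + q.2) = q.1 / 2 * (1 - q.2) by field.
rewrite !pmulr_rgt0//; split=> [[h1 h2]|/andP[h1 h2]]; first by apply/andP; split; lra.
by split; lra.
Qed.

(** With x fixed, y is replaced by s = x + y; after an exchange of the integrals, with s fixed, x is
    replaced by t through x = (s/2) t + s/2, whence the Jacobian s/2. For s <= 0 both sides
    vanish. *)
Lemma integral_polar (G : RT * RT -> \bar R) :
    measurable_fun setT G -> (forall p, 0 <= G p)%E ->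
  (\int[mu \x mu]_(p in pos `*` pos) G p =
   \int[mu \x mu]_q ((polar_weight q)%:E * G (polar q)))%E.
Proof.
move=> mG G0; rewrite integral_mkcond; set GD := G \_ _.
have mD : measurable (pos `*` pos) by apply: measurableX; exact: measurable_itvRT.
have mGD : measurable_fun setT GD.
  by apply/(measurable_restrictT G mD); exact: measurable_funTS.
have GD0 p : (0 <= GD p)%E by rewrite /GD patchE; case: ifP.
have mH : measurable_fun setT (fun q => (polar_weight q)%:E * G (polar q))%E.
  apply: emeasurable_funM; first by apply/measurable_EFinP; exact: measurable_polar_weight.
  exact: (measurableT_comp mG measurable_polar).
have H0 q : (0 <= (polar_weight q)%:E * G (polar q))%E.
  by rewrite mule_ge0// lee_fin polar_weight_ge0.
have mK : measurable_fun setT (fun p : RT * RT => GD (p.1, p.2 - p.1)).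
  have mB : measurable_fun setT (fun p : RT * RT => p.2 - p.1 : RT) by exact: measurable_funB.
  apply: (measurableT_comp mGD); apply/measurable_fun_pairP.
  by split; [exact: measurable_fst|exact: mB].
etransitivity; first exact: (fubini_tonelli1 _ mGD GD0).
transitivity (\int[mu]_x \int[mu]_s GD (x, (s - x)%R))%E.
  apply: eq_integral => x _; rewrite /fubini_F /=.
  etransitivity.
    by apply: (@ge0_integral_affine R 1 (- x) (fun y => GD (x, y))) => //;
      exact: measurable_fun_pair2.
  by apply: eq_integral => s _; rewrite mul1e mul1r.
etransitivity; first exact: (fubini_tonelli _ mK (fun=> GD0 _)).
apply/esym; etransitivity; first exact: (fubini_tonelli1 _ mH H0).
apply: eq_integral => s _; rewrite /fubini_F /=.
have [s0|s0] := ltP 0 s; last first.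
  transitivity (0 : \bar R).
    apply: integral0_eq => t _; rewrite /polar_weight indicE mem_setE in_itv /= ltNge s0 /=.
    by rewrite !mul0r mul0e.
  apply/esym/integral0_eq => x _; rewrite /GD patchE memNset//= !in_itv /= !andbT.
  by move=> [x0 sx]; move: s0; rewrite leNgt => /negP; apply; lra.
have s2 : 0 < s / 2 by rewrite divr_gt0.
apply/esym; etransitivity.
  by apply: (@ge0_integral_affine R _ (s / 2) (fun x => GD (x, s - x)) s2) => //;
    exact: (measurable_fun_pair1 s mK).
have s_pos : s \in pos by rewrite inE /= in_itv /= s0.
apply: eq_integral => t _; rewrite /polar_weight !indicE s_pos mul1r.
rewrite /GD patchE -/(polar (s, t)).
have [/set_mem tU|tU] := boolP (t \in _).
  by rewrite mem_set ?mulr1//; apply/polar_domain.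
rewrite memNset ?mulr0 ?mule0 ?mul0e// => /(polar_domain (q := (s, t)) s0) /mem_set.
exact/negP.
Qed.

Lemma polar_gamma a b q :
  (polar_weight q)%:C * (gammaC a (polar q).1 * gammaC b (polar q).2) =
  ((\1_pos q.1)%:C * gammaC (a + b) q.1) *
  ((\1_unit_ball q.2)%:C * (cpow 2^-1 (a + b - 1) * betaC a b q.2)).
Proof.
case: q => s t; rewrite /polar_weight !indicE /=.
have [/set_mem s0|_] := boolP (s \in _); last by rewrite !mul0r.
have [/set_mem t1|_] := boolP (t \in _); last by rewrite !(mulr0, mul0r).
move: s0 t1; rewrite /= !in_itv /= andbT => s0 /andP[t_gt t_lt].
have s2 : 0 < s / 2 by rewrite divr_gt0.
have p1 : 0 < 1 + t by lra.
have p2 : 0 < 1 - t by lra.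
have -> : s / 2 * t + s / 2 = s / 2 * (1 + t) by ring.
have -> : s - s / 2 * (1 + t) = s / 2 * (1 - t) by field.
rewrite /gammaC /betaC (cpowM _ s2 p1) (cpowM _ s2 p2) !mul1r mulr1.
(* The Jacobian supplies the missing unit in the exponent of s/2, which becomes 1 + (a - 1) + (b -
   1) = a + b - 1. *)
have -> : (s / 2)%:C = cpow (s / 2) 1 by rewrite (cpow_nat 1).
have expE : (expR (- s))%:C = (expR (- (s / 2 * (1 + t))))%:C * (expR (- (s / 2 * (1 - t))))%:C.
  by rewrite -rmorphM /= -expRD; congr ((expR _)%:C); field.
have eE : a + b - 1 = 1 + (a - 1) + (b - 1) by ring.
have : cpow s (a + b - 1) * cpow 2^-1 (a + b - 1) =
    cpow (s / 2) 1 * cpow (s / 2) (a - 1) * cpow (s / 2) (b - 1).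
  by rewrite -!cpowD// -eE -cpowM// invr_gt0.
rewrite expE; set A := cpow s _; set B := cpow 2^-1 _ => AB.
transitivity (cpow (s / 2) 1 * cpow (s / 2) (a - 1) * cpow (s / 2) (b - 1) *
   (cpow (1 + t) (a - 1) * cpow (1 - t) (b - 1) *
   ((expR (- (s / 2 * (1 + t))))%:C * (expR (- (s / 2 * (1 - t))))%:C))).
  by ring.
by rewrite -AB; ring.
Qed.

Definition cmeasurable d (T : measurableType d) (f : T -> R[i]) :=
  measurable_fun setT (fun x => complex.Re (f x)) /\
  measurable_fun setT (fun x => complex.Im (f x)).

Lemma cmeasurableM d (T : measurableType d) (f g : T -> R[i]) :
  cmeasurable f -> cmeasurable g -> cmeasurable (fun x => f x * g x).
Proof.
move=> [mf mf'] [mg mg']; split.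
  by under eq_fun do rewrite complex_ReM; apply: measurable_funB; exact: measurable_funM.
by under eq_fun do rewrite complex_ImM; apply: measurable_funD; exact: measurable_funM.
Qed.

Lemma cmeasurable_real d (T : measurableType d) (f : T -> R) :
  measurable_fun setT f -> cmeasurable (fun x => (f x)%:C).
Proof. by move=> mf; split => //=; exact: measurable_cst. Qed.

Lemma cmeasurable_cpow d (T : measurableType d) (f : T -> R) s :
  measurable_fun setT f -> cmeasurable (fun x => cpow (f x) s).
Proof. by move=> mf; split; [exact: measurable_Re_cpow|exact: measurable_Im_cpow]. Qed.

Lemma cmeasurable_comp d d' (T : measurableType d) (T' : measurableType d')
    (f : T -> R[i]) (g : T' -> T) :
  cmeasurable f -> measurable_fun setT g -> cmeasurable (fun x => f (g x)).
Proof.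
by move=> [mf mf'] mg; split; [exact: (measurableT_comp mf mg)|exact: (measurableT_comp mf' mg)].
Qed.

Lemma cmeasurable_indic d (T : measurableType d) (A : set T) :
  measurable A -> cmeasurable (fun x => (\1_A x)%:C).
Proof. by move=> mA; apply: cmeasurable_real; exact: measurable_indic. Qed.

Lemma cmeasurable_gammaC z : cmeasurable (gammaC z).
Proof.
apply: cmeasurableM; first exact: cmeasurable_cpow.
apply: cmeasurable_real; apply: (measurableT_comp (f := expR)) => //.
Qed.

Lemma cmeasurable_betaC a b : cmeasurable (betaC a b).
Proof.
apply: cmeasurableM; apply: cmeasurable_cpow; first exact: measurable_funD.
exact: measurable_funB.
Qed.

Lemma normc_gammaC z t : normc (gammaC z t) = gamma_fun (complex.Re z) t.
Proof.
rewrite normc_mul normc_cpow normc_real ger0_norm ?expR_ge0// /gamma_fun.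
by case: z.
Qed.

Lemma cintegrable_gamma z : 0 < complex.Re z -> cintegrable mu pos (gammaC z).
Proof.
move=> z0; have [mRe mIm] := cmeasurable_gammaC z.
apply: (cintegrable_le (measurable_itvRT _) _ _ (integrable_gamma z0)).
- exact: measurable_funTS.
- exact: measurable_funTS.
- by move=> t _; rewrite normc_gammaC.
Qed.

Lemma GammaE z : Gamma z = cintegral mu pos (gammaC z).
Proof. by []. Qed.

Lemma mu_pos_gt0 : (0 < mu pos)%E.
Proof. by rewrite lebesgue_measure_itv /= !ltry. Qed.

(** No estimate is made at the ends of the interval. [integral_polar], applied to absolute values,
    equates a finite product of two Gamma integrals with a positive Gamma integral times a positive
    multiple of the integral of |[betaC]|, which must then be finite. *)
Lemma beta_integrable a b : 0 < complex.Re a -> 0 < complex.Re b ->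
  cintegrable mu unit_ball (betaC a b).
Proof.
move=> a0 b0; have mU : measurable unit_ball by exact: measurable_itvRT.
have mP : measurable pos by exact: measurable_itvRT.
pose h z (t : RT) := (normc ((\1_pos t)%:C * gammaC z t))%:E : \bar R.
pose k (t : RT) := (normc ((\1_unit_ball t)%:C * (cpow 2^-1 (a + b - 1) * betaC a b t)))%:E : \bar R.
have h_restrict z : h z = (EFin \o gamma_fun (complex.Re z)) \_ pos.
  apply/funext => t; rewrite /h patchE normc_mul normc_real normc_gammaC indicE.
  by case: (t \in pos); rewrite ?normr1 ?mul1r// normr0 mul0r.
have mh z : measurable_fun setT (h z).
  have mg : measurable_fun setT (EFin \o gamma_fun (complex.Re z) : RT -> \bar R).
    by apply/measurable_EFinP; exact: measurable_gamma_fun.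
  by rewrite h_restrict; exact: ((measurable_restrictT _ mP).1 (measurable_funTS mg)).
have mk : measurable_fun setT k.
  apply: (measurableT_comp (f := EFin)); first exact: EFin_measurable.
  under eq_fun do rewrite normc_mul normc_real normc_mul normc_cpow normc_mul !normc_cpow.
  apply: measurable_funM; first by apply: measurableT_comp => //; exact: measurable_indic.
  apply: measurable_funM => //; apply: measurable_funM;
    apply: (measurableT_comp (measurable_powR _)).
    exact: measurable_funD.
  exact: measurable_funB.
have h0 z t : (0 <= h z t)%E by rewrite lee_fin normc_ge0.
have k0 t : (0 <= k t)%E by rewrite lee_fin normc_ge0.
have int_h z : 0 < complex.Re z -> (0 < \int[mu]_t h z t < +oo)%E.
  move=> z0; rewrite h_restrict -integral_mkcond integral_gt0//=.
  - have /integrableP[_] := integrable_gamma z0.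
    by under eq_integral do rewrite gee0_abs ?lee_fin ?gamma_fun_ge0//.
  - by apply: measurable_funTS; exact: measurable_gamma_fun.
  - by move=> t; rewrite /= in_itv /= andbT => t0; exact: gamma_fun_gt0.
  - exact: mu_pos_gt0.
have mgg : measurable_fun setT (fun p : RT * RT =>
    (normc (gammaC a p.1) * normc (gammaC b p.2))%:E : \bar R).
  apply/measurable_EFinP; under eq_fun do rewrite !normc_gammaC.
  apply: measurable_funM.
    exact: (measurableT_comp (measurable_gamma_fun _) measurable_fst).
  exact: (measurableT_comp (measurable_gamma_fun _) measurable_snd).
have gg0 (p : RT * RT) : (0 <= (normc (gammaC a p.1) * normc (gammaC b p.2))%:E)%E.
  by rewrite lee_fin mulr_ge0 ?normc_ge0.
have := integral_polar mgg gg0.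
have -> : (\int[mu \x mu]_(p in pos `*` pos)
    (normc (gammaC a p.1) * normc (gammaC b p.2))%:E =
    \int[mu]_t h a t * \int[mu]_t h b t)%E.
  rewrite -ge0_integral_tensor// integral_mkcond; apply: eq_integral => p _.
  rewrite patchE /h [normc (_%:C * gammaC a _)]normc_mul [normc (_%:C * gammaC b _)]normc_mul.
  rewrite !normc_real !indicE in_setX.
  by case: (p.1 \in _); case: (p.2 \in _); rewrite /= ?normr1 ?normr0 ?mul1r ?mul0r// ?mule0 ?mul0e.
have -> : (\int[mu \x mu]_q ((polar_weight q)%:E *
      (normc (gammaC a (polar q).1) * normc (gammaC b (polar q).2))%:E) =
    \int[mu]_s h (a + b)%R s * \int[mu]_t k t)%E.
  rewrite -ge0_integral_tensor//; apply: eq_integral => q _.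
  rewrite /h /k -!EFinM -[polar_weight q]ger0_norm ?polar_weight_ge0//.
  by rewrite -normc_real -!normc_mul polar_gamma.
move=> eq_int.
have ab0 : 0 < complex.Re (a + b) by rewrite raddfD /= addr_gt0.
have int_k : (\int[mu]_t k t < +oo)%E.
  have /andP[h_gt0 _] := int_h _ ab0.
  rewrite ltNge leye_eq; apply/negP => /eqP k_oo; move: eq_int; rewrite k_oo.
  rewrite gt0_muley//.
  have /andP[ha0 hay] := int_h _ a0; have /andP[hb0 hby] := int_h _ b0.
  move=> e; have : (\int[mu]_t h a t * \int[mu]_t h b t < +oo)%E.
    by rewrite lte_mul_pinfty ?ltW// ge0_fin_numE ?ltW.
  by rewrite e ltxx.
have c_neq0 : 0 < normc (cpow (2^-1 : R) (a + b - 1)).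
  by rewrite normc_cpow powR_gt0// invr_gt0.
have [mRe mIm] := cmeasurable_betaC a b.
have ib : mu.-integrable unit_ball (EFin \o (fun t => normc (betaC a b t))).
  have : mu.-integrable setT k.
    apply/integrableP; split => //.
    by under eq_integral do rewrite gee0_abs//.
  move=> /(integrableZl measurableT (normc (cpow (2^-1 : R) (a + b - 1)))^-1) ik.
  apply/(integrable_mkcond _ mU); apply: eq_integrable ik => // t _.
  rewrite patchE /k -EFinM normc_mul normc_real normc_mul indicE.
  case: (t \in _); last by rewrite normr0 mul0r mulr0.
  by rewrite normr1 mul1r mulrA mulVf ?gt_eqF// mul1r.
apply: (cintegrable_le mU _ _ ib) => //; exact: measurable_funTS.
Qed.

Lemma Gamma_beta a b : 0 < complex.Re a -> 0 < complex.Re b ->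
  Gamma a * Gamma b =
  Gamma (a + b) * (cpow 2^-1 (a + b - 1) * cintegral mu unit_ball (betaC a b)).
Proof.
move=> a0 b0; have mU : measurable unit_ball by exact: measurable_itvRT.
have mP : measurable pos by exact: measurable_itvRT.
have ab0 : 0 < complex.Re (a + b) by rewrite raddfD /= addr_gt0.
have iB := beta_integrable a0 b0.
have [iZB intZB] := cintegralZl mU (cpow 2^-1 (a + b - 1)) iB.
have [mRe mIm] : cmeasurable (fun p : RT * RT => gammaC a p.1 * gammaC b p.2).
  apply: cmeasurableM; apply: cmeasurable_comp => //; exact: cmeasurable_gammaC.
have iind (A : set RT) f : measurable A -> cintegrable mu A f ->
    cintegrable mu setT (fun t => (\1_A t)%:C * f t).
  by move=> mA iF; apply/cintegrable_indic.
have [_] := cintegral_transport polar_weight_ge0 integral_polar mRe mIm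
  (iind _ _ mP (cintegrable_gamma ab0)) (iind _ _ mU iZB) (polar_gamma a b).
rewrite !cintegral_indic intZB !GammaE => <-.
(* A second use of [cintegral_transport], along the identity with the indicator of the quadrant as
   weight, identifies the same double integral with Gamma(a) Gamma(b). *)
have ind_ge0 (p : RT * RT) : 0 <= \1_(pos `*` pos) p :> R by rewrite indicE.
have ind_transport (G : RT * RT -> \bar R) :
    measurable_fun setT G -> (forall p, 0 <= G p)%E ->
    (\int[mu \x mu]_(p in pos `*` pos) G p =
     \int[mu \x mu]_p ((\1_(pos `*` pos) p)%:E * G (id p)))%E.
  move=> _ _; rewrite integral_mkcond; apply: eq_integral => p _.
  by rewrite patchE indicE; case: (p \in _); rewrite ?mul1e ?mul0e.
have ind_split (p : RT * RT) : (\1_(pos `*` pos) p)%:C * (gammaC a p.1 * gammaC b p.2) =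
    ((\1_pos p.1)%:C * gammaC a p.1) * ((\1_pos p.2)%:C * gammaC b p.2).
  rewrite !indicE in_setX.
  by case: (p.1 \in _); case: (p.2 \in _); rewrite /= ?mul1r ?mul0r ?mulr0.
have [_] := cintegral_transport ind_ge0 ind_transport mRe mIm
  (iind _ _ mP (cintegrable_gamma a0)) (iind _ _ mP (cintegrable_gamma b0)) ind_split.
by rewrite !cintegral_indic => ->.
Qed.

End beta.

(** * The Gamma function has no zero *)

Section gamma_nonzero.
Context (R : realType).
Local Notation RT := (measurableTypeR R).
Local Notation mu := (@lebesgue_measure R).
Local Notation pos := (`]0%R, +oo[%classic : set RT).
Local Open Scope complex_scope.

Lemma integral_affine (c d : R) (phi : RT -> R) : 0 < c -> measurable_fun setT phi ->
  (\int[mu]_x (phi x)%:E = \int[mu]_x (c * phi (c * x + d))%:E)%E.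
Proof.
move=> c0 mphi; rewrite integralE [RHS]integralE.
have mE : measurable_fun setT (EFin \o phi) by exact/measurable_EFinP.
congr (_ - _)%E.
  etransitivity; first exact: (ge0_integral_affine d c0 (measurable_funepos mE)).
  apply: eq_integral => x _.
  by rewrite !funeposE -!EFin_max -EFinM maxr_pMr ?ltW// mulr0.
etransitivity; first exact: (ge0_integral_affine d c0 (measurable_funeneg mE)).
apply: eq_integral => x _.
by rewrite !funenegE -!EFinN -!EFin_max -EFinM maxr_pMr ?ltW// mulr0 mulrN.
Qed.

Lemma cintegral_affine (c d : R) (f : RT -> R[i]) : 0 < c -> cmeasurable f ->
  cintegral mu setT f = cintegral mu setT (fun x => c%:C * f (c * x + d)).
Proof.
move=> c0 [mRe mIm]; rewrite /cintegral /Rintegral.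
rewrite (integral_affine d c0 mRe) (integral_affine d c0 mIm).
by congr (fine _ +i* fine _); apply: eq_integral => x _; rewrite ?complex_ReZ ?complex_ImZ.
Qed.

(** Over the positive half-line its integral is 2^-z Gamma(z), by scaling, so it vanishes whenever
    Gamma(z) does. *)
Definition gamma2C (z : R[i]) (t : RT) : R[i] := cpow t (z - 1) * (expR (- (2 * t)))%:C.

Lemma cmeasurable_gamma2C z : cmeasurable (gamma2C z).
Proof.
apply: cmeasurableM; first exact: cmeasurable_cpow.
apply: cmeasurable_real; apply: (measurableT_comp (f := expR)) => //.
by apply: measurable_funN; exact: measurable_funM.
Qed.

Lemma cintegrable_gamma2C z : 0 < complex.Re z -> cintegrable mu pos (gamma2C z).
Proof.
move=> z0; have [mRe mIm] := cmeasurable_gamma2C z.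
apply: (cintegrable_le (measurable_itvRT _) _ _ (integrable_gamma z0)).
- exact: measurable_funTS.
- exact: measurable_funTS.
move=> t t_pos; have {t_pos} t0 : 0 < t by move: t_pos; rewrite /= in_itv /= andbT.
rewrite /gamma2C normc_mul normc_cpow normc_real ger0_norm ?expR_ge0// /gamma_fun.
rewrite (_ : complex.Re (z - 1) = complex.Re z - 1); last by case: z {z0 mRe mIm}.
by rewrite ler_wpM2l ?powR_ge0// ler_expR; lra.
Qed.

Lemma cintegral_gamma2C z : 0 < complex.Re z -> Gamma z = 0 ->
  cintegral mu pos (gamma2C z) = 0.
Proof.
move=> z0; rewrite GammaE -cintegral_indic.
have two_gt0 : 0 < 2 :> R by [].
rewrite (cintegral_affine 0 two_gt0); last first.
  apply: cmeasurableM; last exact: cmeasurable_gammaC.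
  by apply: cmeasurable_indic; exact: measurable_itvRT.
have -> : (fun x : RT => 2%:C * ((\1_pos (2 * x + 0))%:C * gammaC z (2 * x + 0))) =
    (fun x : RT => (2%:C * cpow 2 (z - 1)) * ((\1_pos x)%:C * gamma2C z x)).
  apply/funext => x; rewrite addr0 !indicE.
  have -> : (2 * x \in pos) = (x \in pos).
    by rewrite !mem_setE !in_itv /= !andbT pmulr_rgt0.
  have [/set_mem|] := boolP (x \in pos); last by rewrite !mul0r !mulr0.
  rewrite /= in_itv /= andbT => x0.
  by rewrite /gammaC /gamma2C cpowM// !mul1r; ring.
have ic : cintegrable mu setT (fun x => (\1_pos x)%:C * gamma2C z x).
  by apply/cintegrable_indic; [exact: measurable_itvRT|exact: cintegrable_gamma2C].
have [_ ->] := cintegralZl measurableT (2%:C * cpow 2 (z - 1)) ic.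
rewrite cintegral_indic => /eqP; rewrite mulf_eq0 => /orP[|/eqP//].
rewrite -[_ == 0]negbK => /negP[]; rewrite mulf_neq0//.
  by rewrite eq_complex /= pnatr_eq0.
apply/eqP => /(congr1 (@ComplexField.Normc.normc R)).
rewrite normc_cpow normc_real normr0 => /eqP.
by rewrite powR_eq0 pnatr_eq0.
Qed.

(** The real part of t^(z-1) (e^(-t) - e^(-2t)) for z = x + iy. The difference of exponentials is
    O(t) at 0, which keeps the integral convergent in the limit z = 0. *)
Definition osc (x y t : R) : R :=
  t `^ (x - 1) * cos (y * ln t) * (expR (- t) - expR (- (2 * t))).

Lemma expB_ge0 (t : R) : 0 < t -> 0 <= expR (- t) - expR (- (2 * t)).
Proof. by move=> t0; rewrite subr_ge0 ler_expR; lra. Qed.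

(** A bound uniform in x' for dominated convergence. For t <= 1 it combines t^(x'-1) <= 1/t with
    e^(-t) - e^(-2t) <= t e^(-t); for t > 1 it uses t^(x'-1) <= t^(x-1). *)
Lemma osc_le (x' x y t : R) : 0 < t -> 0 < x' -> x' <= x ->
  `|osc x' y t| <= gamma_fun 1 t + gamma_fun x t.
Proof.
move=> t0 x'0 x'x.
have le_abs : `|osc x' y t| <= t `^ (x' - 1) * (expR (- t) - expR (- (2 * t))).
  rewrite /osc !normrM (ger0_norm (powR_ge0 _ _)) (ger0_norm (expB_ge0 t0)).
  rewrite ler_wpM2r ?expB_ge0// ler_piMr ?powR_ge0//.
  by rewrite ler_norml cos_geN1 cos_le1.
apply: (le_trans le_abs); have [t1|t1] := leP t 1.
  apply: (@le_trans _ _ (gamma_fun 1 t)); last by rewrite lerDl gamma_fun_ge0.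
  rewrite /gamma_fun subrr powRr0 mul1r.
  apply: (@le_trans _ _ (t^-1 * (expR (- t) * t))); last by rewrite mulrCA mulVf ?mulr1// gt_eqF.
  apply: ler_pM; rewrite ?powR_ge0 ?expB_ge0//.
    rewrite -(powR_inv1 (ltW t0)); apply: ger_powR; rewrite ?t0 ?t1//; lra.
  rewrite (_ : - (2 * t) = - t + - t); last by ring.
  rewrite expRD -[X in X - _]mulr1 -mulrBr ler_wpM2l ?expR_ge0//.
  by have := expR_ge1Dx (- t); lra.
apply: (@le_trans _ _ (gamma_fun x t)); last by rewrite lerDr gamma_fun_ge0.
apply: ler_pM; rewrite ?powR_ge0 ?expB_ge0//.
  by apply: ler_powR; [exact: ltW|lra].
by rewrite lerBlDr lerDl expR_ge0.
Qed.

Lemma measurable_osc x y : measurable_fun setT (osc x y : RT -> R).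
Proof.
apply: measurable_funM; first apply: measurable_funM.
- exact: measurable_powR.
- apply: (measurableT_comp (continuous_measurable_fun (@continuous_cos R))).
  by apply: measurable_funM => //; exact: measurable_ln.
- apply: measurable_funB; apply: (measurableT_comp (f := expR)) => //.
  by apply: measurable_funN; exact: measurable_funM.
Qed.

Lemma osc_gamma z t : osc (complex.Re z) (complex.Im z) t =
  complex.Re (gammaC z t) - complex.Re (gamma2C z t).
Proof.
rewrite /osc /gammaC /gamma2C /cpow !complex_ReM !complex_ImM /=.
have -> : complex.Re (z - 1) = complex.Re z - 1 by case: z.
have -> : complex.Im (z - 1) = complex.Im z by case: z => ? ?; rewrite /= oppr0 addr0.
by ring.
Qed.

Lemma integral_osc z : 0 < complex.Re z -> Gamma z = 0 ->
  (\int[mu]_(t in pos) (osc (complex.Re z) (complex.Im z) t)%:E = 0)%E.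
Proof.
move=> z0 Gz0.
have mP : measurable pos by exact: measurable_itvRT.
have [i1 _] := cintegrable_gamma z0; have [i2 _] := cintegrable_gamma2C z0.
have := cintegral_gamma2C z0 Gz0; move: Gz0; rewrite GammaE.
move=> /(congr1 (fun u => complex.Re u)) /= int1 /(congr1 (fun u => complex.Re u)) /= int2.
have e1 : (\int[mu]_(t in pos) (complex.Re (gammaC z t))%:E = 0)%E.
  by rewrite -[LHS](fineK (integrable_fin_num mP i1)); congr _%:E; exact: int1.
have e2 : (\int[mu]_(t in pos) (complex.Re (gamma2C z t))%:E = 0)%E.
  by rewrite -[LHS](fineK (integrable_fin_num mP i2)); congr _%:E; exact: int2.
under eq_integral do rewrite osc_gamma EFinB.
by rewrite integralB// e1 e2 subee.
Qed.

Lemma Gamma_neq0 (z : R[i]) : 0 < complex.Re z -> Gamma z != 0.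
Proof.
move=> z0; apply/eqP => Gz0.
have mP : measurable pos by exact: measurable_itvRT.
pose x n : R := complex.Re z * 2^-1 ^+ n; pose y n : R := complex.Im z * 2^-1 ^+ n.
have x_gt0 n : 0 < x n by rewrite mulr_gt0// exprn_gt0// invr_gt0.
have x_le n : x n <= complex.Re z.
  by rewrite (ler_piMr (ltW z0))// exprn_ile1 ?invr_ge0// invf_le1// ler1n.
have Gn n : Gamma (x n +i* y n) = 0.
  elim: n => [|n IH]; first by rewrite /x /y expr0 !mulr1; case: z Gz0 {z0 x y x_gt0 x_le}.
  have := Gamma_beta (a := x n.+1 +i* y n.+1) (b := x n.+1 +i* y n.+1) (x_gt0 _) (x_gt0 _).
  have -> : (x n.+1 +i* y n.+1) + (x n.+1 +i* y n.+1) = x n +i* y n.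
    by apply/eqP; rewrite eq_complex /= /x /y !exprS; apply/andP; split; apply/eqP; field.
  by rewrite IH mul0r => /eqP; rewrite mulf_eq0 orbb => /eqP.
have int0 n : (\int[mu]_(t in pos) (osc (x n) (y n) t)%:E = 0)%E.
  exact: (integral_osc (z := x n +i* y n) (x_gt0 n) (Gn n)).
have half_lt1 : `|2^-1 : R| < 1 by rewrite ger0_norm ?invr_ge0// invf_lt1// ltr1n.
have x_cvg : x n @[n --> \oo] --> (0 : R) by exact: cvg_geometric.
have y_cvg : y n @[n --> \oo] --> (0 : R) by exact: cvg_geometric.
have i1 : mu.-integrable pos (fun t => (gamma_fun 1 t + gamma_fun (complex.Re z) t)%:E).
  exact: (integrableD mP (integrable_gamma ltr01) (integrable_gamma z0)).
have [| | | | |_ _] := @dominated_convergence _ RT R mu pos mP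
  (fun n t => (osc (x n) (y n) t)%:E) (fun t => (osc 0 0 t)%:E)
  (fun t => (gamma_fun 1 t + gamma_fun (complex.Re z) t)%:E).
- by move=> n; apply/measurable_EFinP; apply: measurable_funTS; exact: measurable_osc.
- by apply/measurable_EFinP; apply: measurable_funTS; exact: measurable_osc.
- apply: aeW => t; rewrite /= in_itv /= andbT => t0.
  apply: cvg_EFin; first exact: nearW.
  apply: cvgM; last exact: cvg_cst.
  apply: cvgM.
    rewrite /powR gt_eqF//.
    apply: (continuous_cvg _ (@continuous_expR R _)).
    apply: cvgM; last exact: cvg_cst.
    by apply: cvgB => //; exact: cvg_cst.
  apply: (continuous_cvg _ (@continuous_cos R _)).
  by apply: cvgM => //; exact: cvg_cst.
- exact: i1.
- apply: aeW => t n; rewrite /= in_itv /= andbT => t0.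
  by rewrite lee_fin; exact: osc_le.
under eq_fun do rewrite int0.
move=> /(cvg_unique _ (cvg_cst _)) int_eq0.
have : (0 < \int[mu]_(t in pos) (osc 0 0 t)%:E)%E.
  apply: (integral_gt0 mP _ _ (mu_pos_gt0 R)).
    by apply: measurable_funTS; exact: measurable_osc.
  move=> t; rewrite /= in_itv /= andbT => t0.
  by rewrite /osc mul0r cos0 mulr1 mulr_gt0 ?powR_gt0// subr_gt0 ltr_expR; lra.
by rewrite -int_eq0 ?ltxx//; exact: ereal_hausdorff.
Qed.

End gamma_nonzero.

(** * The recursion for S_N *)

Section regular_region.
Context (R : realType).
Local Notation RT := (measurableTypeR R).
Local Notation mu := (@lebesgue_measure R).

Lemma horner_monic_poly n (a : n.-tuple RT) (x : R) :
  (monic_poly a).[x] = x ^+ n + \sum_(i < n) tnth a i * x ^+ (n - i.+1).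
Proof. by have := horner_map_monic_poly idfun a x; rewrite map_poly_id. Qed.

Lemma horner_schur n t (b : n.-tuple RT) (x : R) : x != 0 ->
  (monic_poly (schur t b)).[x] =
  x * (monic_poly b).[x] + t * (x ^+ n * (monic_poly b).[x^-1]).
Proof.
move=> x0; have := horner_map_schur idfun t b x0.
by rewrite !map_poly_id.
Qed.

Lemma horner_schur1 n t (b : n.-tuple RT) :
  (monic_poly (schur t b)).[1] = (1 + t) * (monic_poly b).[1].
Proof. by rewrite horner_schur ?oner_eq0// invr1 expr1n; ring. Qed.

Lemma horner_schurN1 n t (b : n.-tuple RT) :
  (monic_poly (schur t b)).[-1] = - ((1 + (-1) ^+ n.+1 * t) * (monic_poly b).[-1]).
Proof. by rewrite horner_schur ?oppr_eq0 ?oner_eq0// invrN1 exprS; ring. Qed.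

Lemma signed_lt1 n (t : R) : `|t| < 1 -> 0 < 1 + (-1) ^+ n * t.
Proof.
rewrite -signr_odd ltr_norml => /andP[? ?].
by case: (odd n); rewrite ?expr1 ?expr0; lra.
Qed.

Lemma norm_horner_schurN1 n t (b : n.-tuple RT) : `|t| < 1 ->
  `|(monic_poly (schur t b)).[-1]| = (1 + (-1) ^+ n.+1 * t) * `|(monic_poly b).[-1]|.
Proof. by move=> t1; rewrite horner_schurN1 normrN normrM gtr0_norm ?signed_lt1. Qed.

Lemma measurable_horner n (x : R) :
  measurable_fun setT (fun a : n.-tuple RT => (monic_poly a).[x] : R).
Proof.
under eq_fun do rewrite horner_monic_poly.
apply: measurable_funD => //; apply: measurable_sum => i.
by apply: measurable_funM => //; exact: measurable_funtnth.
Qed.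

(* Where cpow is multiplicative; the rest of Omega is a null set. *)
Definition regular n : set (n.-tuple RT) :=
  [set a | (0 < (monic_poly a).[1]) && (0 < `|(monic_poly a).[-1]|)].

Lemma measurable_regular n : measurable (@regular n).
Proof.
have mr : measurable_fun setT (fun a : n.-tuple RT =>
    (0 < (monic_poly a).[1]) && (0 < `|(monic_poly a).[-1]|)).
  apply: measurable_and; apply: measurable_fun_ltr => //; first exact: measurable_horner.
  by apply: measurableT_comp => //; exact: measurable_horner.
by have := mr measurableT [set true] I; rewrite setTI.
Qed.

Lemma schur_regular n t (b : n.-tuple RT) : `|t| < 1 -> regular (schur t b) <-> regular b.
Proof.
move=> t1; have t0 : 0 < 1 + t by move: t1; rewrite ltr_norml => /andP[? _]; lra.
by rewrite /regular /= horner_schur1 norm_horner_schurN1// !pmulr_rgt0 ?signed_lt1.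
Qed.

(** The recursion preserves [regular], hence also the singular set: its measure in degree n + 1 is
    an integral of the Jacobian times its measure in degree n. In degree 0, where P = 1, it is
    empty. *)
Lemma Omega_singular_null n : lebesgue_tuple R n (Omega R n `\` @regular n) = 0%E.
Proof.
elim: n => [|n IH].
  rewrite (_ : _ `\` _ = set0) ?measure0// -subset0 => a [_]; apply.
  by rewrite /regular /= !horner_monic_poly !big_ord0 !expr0 !addr0 normr1 ltr01.
have mD k : measurable (Omega R k `\` @regular k).
  by apply: measurableD; [exact: measurable_Omega|exact: measurable_regular].
have last_le a : (Omega R n.+1 `\` @regular n.+1) a -> `|tnth a ord_max : R| <= 1.
  by move=> [/Omega_last].
have schurE t b : `|t| < 1 -> (Omega R n.+1 `\` @regular n.+1) (schur t b) <->
    (Omega R n `\` @regular n) b.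
  by move=> t1; rewrite /setD /= schur_Omega// schur_regular.
have := integral_schur (mD n) (mD n.+1) last_le schurE (G := cst 1%E) (measurable_cst _) (fun=> lee01).
rewrite (integral_cst _ (mD n.+1)) mul1e => ->.
pose J (t : RT) : \bar R := (\1_(`](-1)%R, 1%R[%classic : set RT) t * twist_jacobian n t)%:E.
transitivity (\int[mu \x lebesgue_tuple R n]_p (J p.1 * (\1_(Omega R n `\` @regular n) p.2)%:E))%E.
  by apply: eq_integral => p _; rewrite mule1.
have mJ : measurable_fun setT J.
  apply/measurable_EFinP; apply: measurable_funM; last exact: measurable_twist_jacobian.
  by apply: measurable_indic; exact: measurable_itvRT.
have mI : measurable_fun setT
    (fun b : n.-tuple RT => (\1_(Omega R n `\` @regular n) b)%:E : \bar R).
  by apply/measurable_EFinP; apply: measurable_indic; exact: mD.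
rewrite (ge0_integral_tensor _ _ mJ mI).
- have -> : (\int[lebesgue_tuple R n]_b (\1_(Omega R n `\` @regular n) b)%:E = 0)%E.
    apply: (etrans (integral_indic _ measurableT (mD n))).
    exact: (etrans (congr1 (lebesgue_tuple R n) (setIT _)) IH).
  exact: mule0.
- move=> t; rewrite lee_fin indicE in_oo1; case: ltP => t1; last by rewrite mul0r.
  by rewrite mul1r twist_jacobian_ge0.
- by move=> b; rewrite lee_fin.
Qed.

End regular_region.

Section selberg.
Context (R : realType) (alpha beta : R[i]).
Hypotheses (alpha0 : 0 < complex.Re alpha) (beta0 : 0 < complex.Re beta).
Local Notation RT := (measurableTypeR R).
Local Notation mu := (@lebesgue_measure R).
Local Notation unit_ball := (`](-1)%R, 1%R[%classic : set RT).
Local Open Scope complex_scope.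

(** One more than the exponent of 1 + t in the step from degree n to n + 1; [beta_arg2] plays the
    same role for 1 - t. Both factors get n./2 from the Jacobian, and 1 + t also gets alpha - 1. For
    odd n, 1 + t gets a further 1 from the middle coordinate and beta - 1 from P(-1); for even n,
    beta - 1 goes to 1 - t. *)
Definition beta_arg1 n : R[i] :=
  if odd n then alpha + beta + (n./2.+1)%:R - 1 else alpha + (n./2)%:R.

Definition beta_arg2 n : R[i] := if odd n then (n./2.+1)%:R else beta + (n./2)%:R.

Lemma Re_nat k : complex.Re (k%:R : R[i]) = k%:R.
Proof. by elim: k => // k IH; rewrite -natr1 raddfD /= IH natr1. Qed.

Lemma beta_arg1_gt0 n : 0 < complex.Re (beta_arg1 n).
Proof.
rewrite /beta_arg1; case: (odd n); rewrite ?raddfB !raddfD /= Re_nat.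
  by rewrite -natr1 addrA addrK ltr_wpDr// addr_gt0.
by rewrite ltr_pwDl.
Qed.

Lemma beta_arg2_gt0 n : 0 < complex.Re (beta_arg2 n).
Proof.
rewrite /beta_arg2; case: (odd n); rewrite ?raddfD /= Re_nat//.
by rewrite ltr_pwDl.
Qed.

Lemma schur_kernel n (t : RT) : `|t| < 1 ->
  (twist_jacobian n t)%:C * (cpow (1 + t) (alpha - 1) * cpow (1 + (-1) ^+ n.+1 * t) (beta - 1)) =
  betaC (beta_arg1 n) (beta_arg2 n) t.
Proof.
rewrite ltr_norml => /andP[t_gt t_lt].
have p1 : 0 < 1 + t by lra.
have p2 : 0 < 1 - t by lra.
rewrite /twist_jacobian /betaC /beta_arg1 /beta_arg2.
have -> : (-1) ^+ n.+1 * t = if odd n then t else - t.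
  by rewrite exprS -signr_odd; case: (odd n); rewrite ?expr1 ?expr0; ring.
have -> : 1 - t ^+ 2 = (1 + t) * (1 - t) by ring.
rewrite exprMn !rmorphM /= -!cpow_nat//; case: (odd n) => /=.
  rewrite -(natr1 n./2).
  have -> : alpha + beta + (n./2%:R + 1) - 1 - 1 =
    n./2%:R + 1%:R + (alpha - 1) + (beta - 1) :> R[i] by ring.
  by rewrite addrK !cpowD//; ring.
rewrite cpow0// -[alpha + _ - 1]addrAC -[beta + _ - 1]addrAC !cpowD//; ring.
Qed.

Lemma cmeasurable_S_integrand n : cmeasurable (S_integrand n alpha beta).
Proof.
apply: cmeasurableM; apply: cmeasurable_cpow; first exact: measurable_horner.
by apply: measurableT_comp => //; exact: measurable_horner.
Qed.

Lemma S_integrand_schur n (p : RT * n.-tuple RT) :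
  (schur_weight (Omega R n `&` @regular R n) p)%:C * S_integrand n.+1 alpha beta (schur p.1 p.2) =
  ((\1_unit_ball p.1)%:C * betaC (beta_arg1 n) (beta_arg2 n) p.1) *
  ((\1_(Omega R n `&` @regular R n) p.2)%:C * S_integrand n alpha beta p.2).
Proof.
case: p => t b; rewrite /schur_weight !indicE in_oo1 /=.
case: ltP => t1; last by rewrite !mul0r.
have [/set_mem [_ /andP[P1 PN1]]|_] := boolP (b \in _); last by rewrite !(mulr0, mul0r).
have t0 : 0 < 1 + t by move: t1; rewrite ltr_norml => /andP[? _]; lra.
rewrite -schur_kernel// /S_integrand horner_schur1 norm_horner_schurN1//.
rewrite (cpowM _ t0 P1) (cpowM _ (signed_lt1 _ t1) PN1) !mul1r mulr1; ring.
Qed.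

(** The factor between degrees n and n + 1, that is K_(n+1). With A and B the two arguments, it is
    2^(A+B-1) times Euler's Beta function at (A, B), the power of 2 coming from the use of ]-1,
    1[ instead of ]0, 1[. *)
Definition schur_factor n : R[i] :=
  cpow 2 (beta_arg1 n + beta_arg2 n - 1) *
  (Gamma (beta_arg1 n) * Gamma (beta_arg2 n) / Gamma (beta_arg1 n + beta_arg2 n)).

(** [Gamma_beta] solved for the integral; dividing by Gamma(A + B) is where [Gamma_neq0] enters. *)
Lemma cintegral_betaC n :
  cintegral mu unit_ball (betaC (beta_arg1 n) (beta_arg2 n)) = schur_factor n.
Proof.
have a0 := beta_arg1_gt0 n; have b0 := beta_arg2_gt0 n.
rewrite /schur_factor (Gamma_beta a0 b0); set K := cintegral _ _ _.
have ab0 : Gamma (beta_arg1 n + beta_arg2 n) != 0.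
  by apply: Gamma_neq0; rewrite raddfD addr_gt0.
have two : cpow (2 : R) (beta_arg1 n + beta_arg2 n - 1) *
    cpow 2^-1 (beta_arg1 n + beta_arg2 n - 1) = 1.
  by rewrite -cpowM ?invr_gt0// mulfV// cpow1.
rewrite [X in _ * X]mulrAC mulfV// mul1r mulrA two mul1r //.
Qed.

(** Each degree contributes one factor, by [cintegral_transport] along [integral_schur]. In degree 0
    the integrand is 1 on a space with a single point of mass 1. Integrability is carried in the
    induction because the transport needs it for both factors. *)
Lemma S_regular n :
  cintegrable (lebesgue_tuple R n) (Omega R n `&` @regular R n) (S_integrand n alpha beta) /\
  cintegral (lebesgue_tuple R n) (Omega R n `&` @regular R n) (S_integrand n alpha beta) =
  \prod_(0 <= k < n) schur_factor k.
Proof.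
have mD k : measurable (Omega R k `&` @regular R k).
  by apply: measurableI; [exact: measurable_Omega|exact: measurable_regular].
elim: n => [|n [iS IH]].
  rewrite big_geq//.
  have -> : Omega R 0 `&` @regular R 0 = setT.
    rewrite Omega0 setTI; apply/seteqP; split => // a _.
    by rewrite /regular /= !horner_monic_poly !big_ord0 !expr0 !addr0 normr1 ltr01.
  have -> : S_integrand 0 alpha beta = fun=> 1.
    apply/funext => a; rewrite /S_integrand !horner_monic_poly !big_ord0 !expr0 !addr0 normr1.
    by rewrite !cpow1 mulr1.
  have mass1 : lebesgue_tuple R 0 [set: 0.-tuple RT] = 1%E by exact: diracT.
  split; [split|].
  - apply/integrableP; split => //=.
    under eq_integral do rewrite normr1.
    rewrite integral_cst// mul1e; exact: (eq_ind_r (fun m => m < +oo)%E (ltry 1) mass1).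
  - exact: integrable0.
  rewrite /cintegral /= Rintegral_cst//.
  rewrite (congr1 fine mass1) mulr1.
  by rewrite /Rintegral integral0.
have last_le a : (Omega R n.+1 `&` @regular R n.+1) a -> `|tnth a ord_max : R| <= 1.
  by move=> [/Omega_last].
have schurE t b : `|t| < 1 -> (Omega R n.+1 `&` @regular R n.+1) (schur t b) <->
    (Omega R n `&` @regular R n) b.
  by move=> t1; rewrite /setI /= schur_Omega// schur_regular.
have [mRe mIm] := cmeasurable_S_integrand n.+1.
have mU : measurable unit_ball by exact: measurable_itvRT.
have iB : cintegrable mu setT
    (fun t => (\1_unit_ball t)%:C * betaC (beta_arg1 n) (beta_arg2 n) t).
  by apply/cintegrable_indic => //; apply: beta_integrable;
    [exact: beta_arg1_gt0|exact: beta_arg2_gt0].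
have iS' := (cintegrable_indic _ (mD n) _).2 iS.
have [? ->] := cintegral_transport (@schur_weight_ge0 R n (Omega R n `&` @regular R n))
  (integral_schur (mD n) (mD n.+1) last_le schurE) mRe mIm iB iS' (@S_integrand_schur n).
split => //; by rewrite !cintegral_indic IH cintegral_betaC big_nat_recr//= mulrC.
Qed.

End selberg.

(** * Assembling the products *)

Section full_region.
Context (R : realType) (alpha beta : R[i]).
Hypotheses (alpha0 : 0 < complex.Re alpha) (beta0 : 0 < complex.Re beta).
Local Notation RT := (measurableTypeR R).

Lemma S_integralE n :
  cintegrable (lebesgue_tuple R n) (Omega R n) (S_integrand n alpha beta) /\
  S_integral n alpha beta = \prod_(0 <= k < n) schur_factor alpha beta k.
Proof.
have mO := @measurable_Omega R n; have mr := @measurable_regular R n.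
have mN : measurable (Omega R n `\` @regular R n) by exact: measurableD.
have N0 := Omega_singular_null R n.
have [mRe mIm] := cmeasurable_S_integrand alpha beta n.
have [[iRe iIm] <-] := S_regular alpha0 beta0 n.
(* The regular part is rewritten as the region minus its null singular part, the form in which a
   negligible set can be restored. *)
rewrite -setDD in iRe iIm *.
have full (f : n.-tuple RT -> R) : measurable_fun setT f ->
    (lebesgue_tuple R n).-integrable
      (Omega R n `\` (Omega R n `\` @regular R n)) (fun a => (f a)%:E) ->
    (lebesgue_tuple R n).-integrable (Omega R n) (fun a => (f a)%:E).
  move=> mf iF; apply/(negligible_integrable mN mO _ N0) => //.
  by apply/measurable_EFinP; exact: measurable_funTS.
have fRe := full _ mRe iRe; have fIm := full _ mIm iIm.
split=> //; rewrite /S_integral /cintegral /Rintegral.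
by congr (complex.Complex (fine _) (fine _)); exact: negligible_integral.
Qed.

End full_region.

Section products.
Variable R : comPzRingType.
Implicit Types F : nat -> R.

Lemma prod_even_index F n :
  \prod_(1 <= k < n.+1 | (2 * k <= n)%N) F k = \prod_(0 <= k < n./2) F k.+1.
Proof.
rewrite -(big_add1 _ _ 0 n./2.+1 xpredT).
rewrite [RHS](big_nat_widen _ _ n.+1) /=; last by lia.
by apply: eq_bigl => k; lia.
Qed.

Lemma prod_odd_index F n :
  \prod_(0 <= k < n.+1 | (2 * k + 1 <= n)%N) F k = \prod_(0 <= k < uphalf n) F k.
Proof.
rewrite [RHS](big_nat_widen _ _ n.+1) /=; last by lia.
by apply: eq_bigl => k; lia.
Qed.

Lemma prod_odd_pred_index F n :
  \prod_(1 <= k < n.+1 | (2 * k - 1 <= n)%N) F k = \prod_(0 <= k < uphalf n) F k.+1.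
Proof.
rewrite -(big_add1 _ _ 0 (uphalf n).+1 xpredT).
rewrite [RHS](big_nat_widen _ _ n.+1) /=; last by lia.
rewrite big_nat_cond [RHS]big_nat_cond; apply: eq_bigl => k; lia.
Qed.

(** Below n there are [n./2] odd indices and [uphalf n] even ones. *)
Lemma prod_halves F (E O : nat -> R) n :
    (forall k, F k.*2 = O k) -> (forall k, F k.*2.+1 = E k) ->
  \prod_(0 <= k < n) F k = (\prod_(0 <= k < n./2) E k) * \prod_(0 <= k < uphalf n) O k.
Proof.
move=> FO FE; elim: n => [|n IH]; first by rewrite !big_geq// mulr1.
rewrite big_nat_recr//= IH uphalf_half -[n in F n]odd_double_half.
case: (odd n); rewrite ?add0n ?add1n.
  by rewrite FE [in RHS]big_nat_recr//= mulrAC.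
by rewrite FO [X in _ = _ * X]big_nat_recr//= mulrA.
Qed.

End products.

Local Open Scope complex_scope.

Section factors.
Context (R : realType) (alpha beta : R[i]).

(** The sum does not depend on the parity of n, although the arguments do. Hence the power of 2 and
    the Gamma denominator come out as a single product in the second form. *)
Lemma beta_argD n : beta_arg1 alpha beta n + beta_arg2 beta n = alpha + beta + n%:R.
Proof.
rewrite /beta_arg1 /beta_arg2 -[in RHS](odd_double_half n) natrD -muln2 natrM.
by case: (odd n); rewrite /= ?mulr0n ?mulr1n -?(natr1 n./2); ring.
Qed.

(** Index n leads to degree n + 1, so even indices give the odd degrees 2k + 1, the second product
    of the first form. *)
Lemma schur_factor_even k : schur_factor alpha beta k.*2 =
  cpow 2 (alpha + beta + 2 * k%:R - 1) *
  (Gamma (alpha + k%:R) * Gamma (beta + k%:R) / Gamma (alpha + beta + 2 * k%:R)).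
Proof.
rewrite /schur_factor beta_argD /beta_arg1 /beta_arg2 odd_double doubleK.
by rewrite -mul2n natrM.
Qed.

Lemma schur_factor_odd k : schur_factor alpha beta k.*2.+1 =
  cpow 2 (alpha + beta + 2 * k.+1%:R - 2) *
  (Gamma (alpha + beta + k.+1%:R - 1) * Gamma (k.+1%:R : R[i]) /
   Gamma (alpha + beta + 2 * k.+1%:R - 1)).
Proof.
rewrite /schur_factor beta_argD /beta_arg1 /beta_arg2 /= odd_double /= uphalf_double.
have -> : alpha + beta + k.*2.+1%:R = alpha + beta + 2 * k.+1%:R - 1.
  by rewrite -(natr1 k.*2) -(natr1 k) -muln2 natrM; ring.
by have -> : alpha + beta + 2 * k.+1%:R - 1 - 1 = alpha + beta + 2 * k.+1%:R - 2 by ring.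
Qed.

Lemma schur_factor_split n : schur_factor alpha beta n =
  cpow 2 (alpha + beta + n.+1%:R - 2) / Gamma (alpha + beta + n.+1%:R - 1) *
  (Gamma (beta_arg1 alpha beta n) * Gamma (beta_arg2 beta n)).
Proof.
rewrite /schur_factor beta_argD -(natr1 n).
have -> : alpha + beta + (n%:R + 1) - 1 = alpha + beta + n%:R by ring.
have -> : alpha + beta + (n%:R + 1) - 2 = alpha + beta + n%:R - 1 by ring.
by ring.
Qed.

End factors.

Theorem theorem3p1 (R : realType) (N : nat) (alpha beta : R[i])
  (hN : (1 <= N)%N)
  (halpha : 0 < complex.Re alpha) (hbeta : 0 < complex.Re beta) :
  let first_form : R[i] :=
    (\prod_(1 <= k < N.+1 | (2 * k <= N)%N)
       (cpow 2 (alpha + beta + 2 * k%:R - 2) *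
        (Gamma (alpha + beta + k%:R - 1) * Gamma (k%:R : R[i]) /
         Gamma (alpha + beta + 2 * k%:R - 1)))) *
    (\prod_(0 <= k < N.+1 | (2 * k + 1 <= N)%N)
       (cpow 2 (alpha + beta + 2 * k%:R - 1) *
        (Gamma (alpha + k%:R) * Gamma (beta + k%:R) /
         Gamma (alpha + beta + 2 * k%:R)))) in
  let second_form : R[i] :=
    (\prod_(1 <= k < N.+1)
       (cpow 2 (alpha + beta + k%:R - 2) / Gamma (alpha + beta + k%:R - 1))) *
    (\prod_(1 <= k < N.+1 | (2 * k <= N)%N)
       (Gamma (alpha + beta + k%:R - 1) * Gamma (k%:R : R[i]))) *
    (\prod_(1 <= k < N.+1 | (2 * k - 1 <= N)%N)
       (Gamma (alpha + k%:R - 1) * Gamma (beta + k%:R - 1))) in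
  [/\ cintegrable (lebesgue_tuple R N) (Omega R N)
        (S_integrand N alpha beta),
      S_integral N alpha beta = first_form
    & first_form = second_form].
Proof.
move=> first_form second_form.
have [integrable_S S_eq] := S_integralE halpha hbeta N.
have first_eq : \prod_(0 <= k < N) schur_factor alpha beta k = first_form.
  rewrite /first_form prod_even_index prod_odd_index.
  apply: prod_halves => k; first exact: schur_factor_even.
  exact: schur_factor_odd.
split; [exact: integrable_S|by rewrite S_eq|].
rewrite -first_eq /second_form prod_even_index prod_odd_pred_index -mulrA.
(* The parity-free quotients are separated off as the product over all degrees; only the Gamma
   numerators remain to be sorted by parity. *)
under eq_bigr do rewrite schur_factor_split.
rewrite big_split /= big_add1 /=; congr (_ * _).
apply: prod_halves => k; rewrite /beta_arg1 /beta_arg2 /= odd_double /=.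
  by rewrite doubleK -(natr1 k) !addrA !addrK.
by rewrite uphalf_double.
Qed.
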